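(* Let $n,k,\Delta_*,m$ be positive integers. Define $$\psi_k=\begin{cases}\dfrac1m\left(\Delta_*^3+\log^9 n\right), & k=3,\\[2mm] \dfrac{k^2}{m}\left(\Delta_*^2+k\Delta_*\log^4 n+k^2\log^9 n\right), & k\ge4,\end{cases}$$ and assume $\psi_k<1$. Then, uniformly for all sequences $\mathbf{d}\in\mathbb{Z}^n$ with $\sum_{v\in[n]}d_v=km$ and $\Delta(\mathbf{d})\le\Delta_*$, $$\Pr_{\mathcal{D}_k(n,m)}(\mathbf{d})=\Pr_{\mathcal{B}_k(n,m)}(\mathbf{d})\exp\!\left(\frac{k-1}{2}\left(1-\frac{n\,\sigma^2(\mathbf{d})}{km}\right)\right)\left(1+O(\sqrt{\psi_k})\right).$$
   Context: A $k$-graph on $V=[n]$ is a set of $k$-element subsets of $V$; degrees and degree sequences are as usual. $\mathcal{D}_k(n,m)$ is the distribution of the degree sequence of a uniformly random $k$-graph on $[n]$ with $m$ edges. $\mathcal{B}_k(n,m)$ is the distribution on $\{\mathbf{d}\in\mathbb{Z}^n:\sum_v d_v=km\}$ given by $\Pr_{\mathcal{B}_k(n,m)}(\mathbf{d})=\binom{n\binom{n-1}{k-1}}{km}^{-1}\prod_{v\in[n]}\binom{\binom{n-1}{k-1}}{d_v}$. $\Delta(\mathbf{d})=\max_v d_v$, and $\sigma^2(\mathbf{d})=\frac1n\sum_v(d_v-d)^2$ where $d=km/n$ is the average. Asymptotics are as $n\to\infty$ with $k,m,\Delta_*$ possibly depending on $n$; ''uniformly'' means the implicit constant in the $O(\cdot)$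 does not depend on $\mathbf{d}$ or the parameters. *)

(* Defs.v *)
From HB Require Import structures.
From mathcomp Require Import all_boot all_order all_algebra.
From mathcomp Require Import reals sequences exp.
Set Implicit Arguments. Unset Strict Implicit. Unset Printing Implicit Defensive.
Import Order.TTheory GRing.Theory Num.Theory.
Local Open Scope ring_scope.

Definition is_kgraph (n k : nat) (G : {set {set 'I_n}}) : bool :=
  [forall e in G, #|e| == k].

Definition deg (n : nat) (G : {set {set 'I_n}}) (v : 'I_n) : nat :=
  #|[set e in G | v \in e]|.

Definition num_kgraphs (n k m : nat) : nat :=
  #|[set G : {set {set 'I_n}} | is_kgraph k G && (#|G| == m)]|.

Definition num_kgraphs_deg (n k m : nat) (d : 'I_n -> int) : nat :=
  #|[set G : {set {set 'I_n}} | [&& is_kgraph k G, #|G| == m &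
        [forall v, (deg G v)%:Z == d v]]]|.

Definition PrD (R : realType) (n k m : nat) (d : 'I_n -> int) : R :=
  (num_kgraphs_deg k m d)%:R / (num_kgraphs n k m)%:R.

Definition binz (N : nat) (z : int) : nat :=
  match z with Posz a => 'C(N, a) | Negz _ => 0%N end.

Definition PrB (R : realType) (n k m : nat) (d : 'I_n -> int) : R :=
  ('C(n * 'C(n.-1, k.-1), k * m)%:R)^-1 *
  \prod_(v < n) ((binz 'C(n.-1, k.-1) (d v))%:R : R).

Definition sigma2 (R : realType) (n k m : nat) (d : 'I_n -> int) : R :=
  (n%:R)^-1 * \sum_(v < n) ((d v)%:~R - (k * m)%:R / n%:R) ^+ 2.

Definition psi (R : realType) (n k m Dstar : nat) : R :=
  let L := ln (n%:R : R) in
  if k == 3%N then (m%:R)^-1 * ((Dstar%:R) ^+ 3 + L ^+ 9)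
  else (k%:R) ^+ 2 / m%:R *
       ((Dstar%:R) ^+ 2 + k%:R * Dstar%:R * L ^+ 4 + (k%:R) ^+ 2 * L ^+ 9).

(* Main.v *)
Require Import Defs.
From HB Require Import structures.
From mathcomp Require Import all_boot all_order all_algebra perm.
From mathcomp Require Import reals sequences exp.
From mathcomp Require Import zify ring lra.
Set Implicit Arguments. Unset Strict Implicit. Unset Printing Implicit Defensive.
Import Order.TTheory GRing.Theory Num.Theory.

(** Split each vertex [v] into [d v] points and deal the [k m] points into [m]
    blocks of size [k].  Such a configuration is a k-graph exactly when it has
    no loop (two points of one vertex in one block) and no repeated block.
    Exclude the loops one pair of points at a time: whatever pairs have already
    been excluded, exchanging a point with another one shows that the next pair
    is a loop with probability [(k-1)/(km) (1 + O(D/m))], where [D] bounds the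
    degrees.  Multiplying over the [h = sum_v d_v (d_v - 1) / 2] pairs gives
    [exp (- (k-1) h / (km) + O(k D^2 / m))] for the probability of having no
    loop.  The same exchanges bound the conditional probability of a repeated
    block by [O(D^3 / m)] if [k = 3] and by [O((k^2 D^2 / m)^2)] if [k >= 4].
    What remains is to compare falling factorials with powers. *)

(** * Exchanging points of configurations *)

(** Write [M = k m]. There are up to [M D / 2] pairs to exclude, each a loop with probability about
    [(k-1)/M], so a relative error [O(k D / M)] in every factor adds up to only [O(k D^2 / m)]; a
    bound within a constant factor would not do. This precision must survive all earlier exclusions,
    whence the set [E] of separated twin pairs in every estimate. An exchange can violate [E] only
    by bringing a point into a block that holds one of its twins, and for given [g] and [p] only
    [O(k D)] partners of [p] do so. Repeated blocks, by contrast, tolerate a factor 2 per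
    coincidence. The exponent of the theorem has two sources. As [n sigma^2 = 2 h + M - M^2 / n], it
    equals [(k-1) M / (2 n) - (k-1) h / M]. The second term is the cost of having no loop. The first
    is the gap between [k! C(n,k) = n (n-1) ... (n-k+1)] and [n^k], raised to the power [m]: edges
    have distinct vertices, whereas the binomial model corresponds to the leading term [n^M]. *)

Section Switching.
Variables (T V : finType) (vx : T -> V) (k m D : nat).
Hypothesis vxD : forall v, (#|[set p | vx p == v]| <= D)%N.

Definition regular : {set {ffun T -> 'I_m}} :=
  [set g : {ffun T -> 'I_m} | [forall j, #|[set p | g p == j]| == k]].

Definition twins : {set T * T} := [set e | (vx e.1 == vx e.2) && (e.1 != e.2)].

Definition avoids (E : seq (T * T)) (g : {ffun T -> 'I_m}) :=
  all (fun e => g e.1 != g e.2) E.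
Definition meets (F : seq (T * T)) (g : {ffun T -> 'I_m}) :=
  all (fun e => g e.1 == g e.2) F.
(** [E] plays the conditioning event and [F] the coincidences whose probability given [E] is sought;
    conditional probabilities appear as ratios of these cardinalities. *)
Definition constrained E F : {set {ffun T -> 'I_m}} :=
  [set g in regular | avoids E g && meets F g].

Definition points (F : seq (T * T)) := unzip1 F ++ unzip2 F.

Definition swap (p r : T) (g : {ffun T -> 'I_m}) := [ffun x => g (tperm p r x)].

Lemma swapK p r : involutive (swap p r).
Proof. by move=> g; apply/ffunP => x; rewrite !ffunE tpermK. Qed.

Lemma regular_swap p r g : (swap p r g \in regular) = (g \in regular).
Proof.
rewrite !inE; apply: eq_forallb => j; congr (_ == k).
rewrite -(card_imset _ (@perm_inj _ (tperm p r))); apply: eq_card => x.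
rewrite inE; apply/imsetP/idP => [[y]|gx].
  by rewrite inE ffunE => ? ->.
by exists (tperm p r x); rewrite ?tpermK // inE ffunE tpermK.
Qed.

Lemma card_block g q : g \in regular -> #|[set r | g r == g q]| = k.
Proof. by rewrite inE => /forallP /(_ (g q)) /eqP. Qed.

Lemma card_block_others g q : g \in regular ->
  #|[set r | (r != q) && (g r == g q)]| = k.-1.
Proof.
move=> /(card_block q); rewrite (cardsD1 q) inE eqxx => <-.
by rewrite add1n /=; apply: eq_card => r; rewrite !inE.
Qed.

Lemma card_twins_of p : (#|[set x | vx x == vx p]| <= D)%N.
Proof. exact: vxD. Qed.

Lemma card_twins : (#|twins| <= #|T| * D)%N.
Proof.
rewrite -sum1_card big_mkcond /=.
rewrite (eq_bigr (fun e : T * T => ((e.1, e.2) \in twins : nat))); last by case.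
rewrite -(pair_big xpredT xpredT (fun a b => ((a, b) \in twins : nat))) /=.
rewrite -sum_nat_const; apply: leq_sum => p _.
rewrite (leq_trans _ (card_twins_of p)) // -sum1_card [leqRHS]big_mkcond /=.
by apply: leq_sum => x _; rewrite !inE /= eq_sym; case: (_ == _) => //=; case: (_ != _).
Qed.

(** If [r] is not blocked, exchanging [p] and [r] preserves all constraints. *)
Definition blocked F (p : T) (g : {ffun T -> 'I_m}) : {set T} :=
  [set r | g r == g p] :|:
  \bigcup_(x in [set x | vx x == vx p]) [set r | g r == g x] :|:
  \bigcup_(x in [set x | g x == g p]) [set r | vx r == vx x] :|:
  [set r in points F].

Lemma card_bigcup_le (I U : finType) (A : {set I}) (B : I -> {set U}) b :
  (forall i, i \in A -> (#|B i| <= b)%N) -> (#|\bigcup_(i in A) B i| <= #|A| * b)%N.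
Proof.
move=> hb; rewrite -sum_nat_const.
elim/big_ind2: _ => [|X x Y y hX hY|i /hb //]; first by rewrite cards0.
by rewrite (leq_trans (leq_card_setU _ _)) // leq_add.
Qed.

Lemma card_blocked F p g : g \in regular -> (0 < D)%N ->
  (#|blocked F p g| <= 3 * k * D + 2 * size F)%N.
Proof.
move=> gG D0.
have h1 : (#|\bigcup_(x in [set x | vx x == vx p]) [set r | g r == g x]| <= D * k)%N.
  apply: leq_trans (card_bigcup_le (b := k) _) _; last by rewrite leq_mul2r vxD orbT.
  by move=> x _; rewrite card_block.
have h2 : (#|\bigcup_(x in [set x | g x == g p]) [set r | vx r == vx x]| <= k * D)%N.
  rewrite -[X in (_ <= X * _)%N](card_block p gG); apply: card_bigcup_le => x _; exact: vxD.
have h3 : (#|[set r in points F]| <= 2 * size F)%N.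
  rewrite cardsE (leq_trans (card_size _)) // size_cat !size_map; lia.
have h0 := card_block p gG.
rewrite /blocked.
(* The four parts of [blocked] in order; the lone [k] is absorbed into [k * D] because [D > 0]. *)
apply: (@leq_trans (k + D * k + k * D + 2 * size F)); last by nia.
do 3![apply: leq_trans (leq_card_setU _ _) _; apply: leq_add => //].
by rewrite h0.
Qed.

(** Neither [p] nor [r] is an endpoint of [F], so [F] is untouched. A pair of [E] that the exchange
    affects joins [p] or [r] to a twin, and the middle two parts of [blocked] rule out a twin of [p]
    in the block of [r] and a twin of [r] in the block of [p]. *)
Lemma swap_unblocked E F p r g : {subset E <= twins} -> p \notin points F ->
  r \notin blocked F p g -> g \in constrained E F -> swap p r g \in constrained E F.
Proof.
move=> EW pF rb; rewrite ![_ \in constrained _ _]inE regular_swap.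
case/and3P=> -> /allP gE /allP gF /=.
move: rb; rewrite !inE !negb_or => /andP[/andP[/andP[grp b2] b3] rF].
have hb2 x : vx x = vx p -> g r != g x.
  move=> hx; apply: contra b2 => gx; apply/bigcupP; exists x; rewrite inE ?hx //.
have hb3 x : g x = g p -> vx r != vx x.
  move=> hx; apply: contra b3 => gx; apply/bigcupP; exists x; rewrite inE ?hx //.
apply/andP; split; apply/allP => -[a b] /[dup] abE.
  move=> /EW; rewrite inE /= => /andP[/eqP vab nab]; have := gE _ abE; rewrite /= => gab.
  rewrite !ffunE.
  case: (tpermP p r a) => [ap|ar|/eqP ap /eqP ar];
    case: (tpermP p r b) => [bp|br|/eqP bp /eqP br] //; subst.
  all: try by rewrite eqxx in nab.
  - exact: hb2.
  - by rewrite eq_sym.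
  - by apply/eqP => h; have := hb3 _ (esym h); rewrite vab eqxx.
  - by rewrite eq_sym; apply: hb2.
  - by apply/eqP => h; have := hb3 _ h; rewrite vab eqxx.
move=> /= abF; have /= gab := gF _ abF.
have aF : a \in points F by rewrite mem_cat (map_f fst abF).
have bF : b \in points F by rewrite mem_cat (map_f snd abF) orbT.
have ne x : x \in points F -> (p != x) && (r != x).
  by move=> xF; apply/andP; split; [apply: contraNneq pF | apply: contraNneq rF] => ->.
by rewrite !ffunE !tpermD //; case/andP: (ne _ aF); case/andP: (ne _ bF).
Qed.

(** Both directions of the exchange argument are measured against this count of pairs [(g, r)] with
    [r] another point of the block of [q]. *)
Lemma sum_block_others E F q :
  (\sum_r \sum_(g : {ffun T -> 'I_m})
     ([&& g \in constrained E F, r != q & g r == g q] : nat)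
   = k.-1 * #|constrained E F|)%N.
Proof.
rewrite exchange_big /= mulnC -sum_nat_const [RHS]big_mkcond /=.
apply: eq_bigr => g _; case: ifPn => [gS|_]; last by rewrite big1.
have gG : g \in regular by move: gS; rewrite inE => /andP[].
rewrite -(card_block_others q gG) -sum1dep_card [RHS]big_mkcond.
by apply: eq_bigr => r _ /=; case: (_ && _).
Qed.

(** If [p] lies beside [q], exchanging [p] with an unblocked [r] puts [r] beside [q] instead. For
    fixed [r] this is an involution, so the pairs [(g, r)] inject into those of
    [sum_block_others]. *)
Lemma meets_upper E F p q : {subset E <= twins} -> p \notin points F ->
  p != q -> (0 < D)%N ->
  (#|constrained E ((p, q) :: F)| * (#|T| - (3 * k * D + 2 * size F))
   <= k.-1 * #|constrained E F|)%N.
Proof.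
move=> EW pF pq D0; rewrite -(sum_block_others E F q).
apply: (@leq_trans (\sum_r \sum_(g : {ffun T -> 'I_m})
  ((g \in constrained E ((p, q) :: F)) && (r \notin blocked F p g) : nat))).
  rewrite exchange_big /= -sum_nat_const [leqLHS]big_mkcond /=.
  apply: leq_sum => g _; case: ifPn => // gS.
  have gG : g \in regular by move: gS; rewrite inE => /andP[].
  apply: (@leq_trans #|~: blocked F p g|).
    by rewrite cardsCs setCK leq_sub2l // card_blocked.
  by rewrite -sum1_card big_mkcond /=; apply: leq_sum => r _; rewrite inE; case: (_ \notin _).
apply: leq_sum => r _.
rewrite [leqRHS](reindex_inj (can_inj (swapK p r))) /=.
apply: leq_sum => g _; case: (boolP (_ && _)) => //= /andP[gS rb].
rewrite [X in (_ <= X)%N](_ : _ = 1%N) //; apply/eqP; rewrite eqb1.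
move: gS; rewrite inE /= => /and4P[gG gE /eqP gpq gF].
have rp : g r != g p by move: rb; rewrite !inE !negb_or -!andbA => /andP[].
have rq : r != q by apply: contraNneq rp => ->; rewrite gpq.
rewrite swap_unblocked //; last by rewrite inE gG gE.
by rewrite rq !ffunE tpermR tpermD // gpq eqxx.
Qed.

(** The reverse exchange: with [r] beside [q], swapping [p] and [r] puts [p] beside [q]. It fails
    only if it unites a pair of [E], that is, if a twin [x] of [p] was in the block of [q], or a
    twin [s] of [r] in the block of [p]; the two sums count these failures. That [x] is not [q]
    itself comes from [E] containing neither orientation of the pair. *)
Lemma meets_lower E p q : {subset E <= twins} ->
  (p, q) \notin E -> (q, p) \notin E -> p != q ->
  (k.-1 * #|constrained E [::]| <=
   #|T| * #|constrained E [:: (p, q)]|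
   + (k.-1 * \sum_(x | [&& vx x == vx p, x != p & x != q]) #|constrained E [:: (x, q)]|
   + \sum_(r | (r != p) && (r != q))
       \sum_(s | [&& vx s == vx r, s != p & s != r])
          #|constrained E [:: (r, q); (s, p)]|))%N.
Proof.
move=> EW pqE qpE pq; rewrite -(sum_block_others E [::] q).
(* Once every term is a double sum, here reindexed by the swap, the inequality can be checked for
   each [(r, g)] separately. *)
have -> : (#|T| * #|constrained E [:: (p, q)]| = \sum_r \sum_(g : {ffun T -> 'I_m})
    (swap p r g \in constrained E [:: (p, q)] : nat))%N.
  rewrite -sum_nat_const; apply: eq_bigr => r _.
  rewrite -sum1_card big_mkcond /= (reindex_inj (can_inj (swapK p r))) /=.
  by apply: eq_bigr => g _; case: (_ \in _).
have -> : (k.-1 * \sum_(x | [&& vx x == vx p, x != p & x != q]) #|constrained E [:: (x, q)]|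
  = \sum_r \sum_(g : {ffun T -> 'I_m}) \sum_(x | [&& vx x == vx p, x != p & x != q])
      ([&& g \in constrained E [:: (x, q)], r != q & g r == g q] : nat))%N.
  under [RHS]eq_bigr do rewrite exchange_big /=.
  rewrite [RHS]exchange_big big_distrr /=; apply: eq_bigr => x _.
  by rewrite sum_block_others.
have -> : (\sum_(r | (r != p) && (r != q)) \sum_(s | [&& vx s == vx r, s != p & s != r])
      #|constrained E [:: (r, q); (s, p)]|
  = \sum_r \sum_(g : {ffun T -> 'I_m}) \sum_(s | [&& vx s == vx r, s != p & s != r])
      ([&& r != p, r != q & g \in constrained E [:: (r, q); (s, p)]] : nat))%N.
  rewrite big_mkcond /=; apply: eq_bigr => r _; rewrite exchange_big /=.
  case: ifPn => [/andP[-> ->]|h].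
    by apply: eq_bigr => s _; rewrite -sum1_card big_mkcond.
  by rewrite big1 // => s _; rewrite big1 // => g _; case: (r != p) h => //= /negPf ->.
rewrite -!big_split /=; apply: leq_sum => r _.
rewrite -!big_split /=; apply: leq_sum => g _.
case: and3P => // -[gS rq grq].
have [hS|hS] := boolP (swap p r g \in _); first by rewrite addSn.
have /andP[gG gE] : (g \in regular) && avoids E g.
  by move: gS; rewrite inE andbT.
have hpq : swap p r g p == swap p r g q.
  rewrite !ffunE tpermL; have [->|qp] := eqVneq q p; first by rewrite tpermL.
  by rewrite tpermD // eq_sym.
have : ~~ avoids E (swap p r g).
  by apply: contra hS => hE; rewrite inE regular_swap gG hE /= hpq.
case/allPn => -[a b] abE; rewrite negbK /= => /eqP hab.
have /andP[/eqP vab nab] : (vx a == vx b) && (a != b) by have := EW _ abE; rewrite inE.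
have gab : g a != g b by exact: (allP gE _ abE).
rewrite add0n.
have rp : r != p.
  by apply: contraNneq gab => rp; move: hab; rewrite !ffunE rp tperm1 !perm1 => ->.
have gpr : g p != g r.
  apply: contraNneq gab => gpr; move: hab; rewrite !ffunE.
  have sw x : g (tperm p r x) = g x by case: tpermP => // ->.
  by rewrite !sw => ->.
have key x : x != p -> x != r -> swap p r g x = g x.
  by move=> xp xr; rewrite ffunE tpermD // eq_sym.
have hp : swap p r g p = g r by rewrite ffunE tpermL.
have hr : swap p r g r = g p by rewrite ffunE tpermR.
(* either [p] met a twin lying in the block of [q], or [r] met one in the block of [p] *)
have case1 x : x != p -> x != r -> vx x = vx p -> g r = g x -> x != q ->
   (0 < \sum_(x | [&& vx x == vx p, x != p & x != q])
      ([&& g \in constrained E [:: (x, q)], r != q & g r == g q] : nat))%N.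
  move=> xp xr vxp gx xq; rewrite (bigD1 x) /=; last by rewrite vxp eqxx xp.
  by rewrite inE gG gE rq grq /= -gx grq.
have case2 s : s != p -> s != r -> vx s = vx r -> g s = g p ->
   (0 < \sum_(s | [&& vx s == vx r, s != p & s != r])
      ([&& r != p, r != q & g \in constrained E [:: (r, q); (s, p)]] : nat))%N.
  move=> sp sr vs gs; rewrite (bigD1 s) /=; last by rewrite vs eqxx sp.
  by rewrite inE gG gE rq rp /= grq gs eqxx.
have [ap|ap] := eqVneq a p.
  subst a; have [br|br] := eqVneq b r.
    by move: hab; rewrite br hp hr => /eqP; rewrite eq_sym (negPf gpr).
  have bp : b != p by rewrite eq_sym.
  apply/ltn_addr/(case1 b) => //; first by rewrite -hp hab key.
  by apply: contraNneq pqE => <-.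
have [ar|ar] := eqVneq a r.
  subst a; have [bp|bp] := eqVneq b p.
    by move: hab; rewrite bp hp hr => /eqP; rewrite (negPf gpr).
  have br : b != r by rewrite eq_sym.
  by apply/ltn_addl/(case2 b) => //; rewrite -hr hab key.
have [bp|bp] := eqVneq b p.
  subst b; apply/ltn_addr/(case1 a) => //; first by rewrite -hp -hab key.
  by apply: contraNneq qpE => <-.
have [br|br] := eqVneq b r.
  by subst b; apply/ltn_addl/(case2 a) => //; rewrite -hr -hab key.
by move: hab; rewrite !key // => /eqP; rewrite (negPf gab).
Qed.

(** * Conditional probabilities of coincidences and the product over all loops *)

Section Bounds.
Variable R : realFieldType.
Local Open Scope ring_scope.
Hypotheses (D0 : (0 < D)%N) (k1 : (1 < k)%N) (Tlarge : (6 * k * D + 32 <= #|T|)%N).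
Let M : R := #|T|%:R.
Let N E F : R := #|constrained E F|%:R.

Let M0 : 0 < M.
Proof. by rewrite ltr0n; lia. Qed.

Let Tlarge_real : 6 * k%:R * D%:R + 32 <= M.
Proof. by rewrite -!natrM -natrD ler_nat. Qed.

Let kR : k%:R = k.-1%:R + 1 :> R.
Proof. by rewrite natr1 prednK // ltnW. Qed.

Let kB1 : k%:R - 1 = k.-1%:R :> R.
Proof. by rewrite kR addrK. Qed.

(** With [c = 3 k D], this is [1 / (M - c) <= (1 + 2 c / M) / M], valid since [2 c <= M]. *)
Lemma meets_upper1 E p q : {subset E <= twins} -> p != q ->
  N E [:: (p, q)] <= (k%:R - 1) / M * (1 + 6 * k%:R * D%:R / M) * N E [::].
Proof.
move=> EW pq; have := meets_upper (F := [::]) EW isT pq D0.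
rewrite muln0 addn0 -(ler_nat R) !natrM natrB ?natrM; last by nia.
rewrite -/M -/(N E [::]) -/(N E _) kB1 => h.
set c : R := 3%:R * k%:R * D%:R in h *.
have -> : 6 * k%:R * D%:R = 2 * c by rewrite /c; ring.
have c0 : 0 <= c by rewrite !mulr_ge0.
have cM : 2 * c <= M.
  by apply: le_trans Tlarge_real; rewrite /c; lra.
have Mc : 0 < M - c by move: M0; lra.
have hM : 1 <= (M - c) / M * (1 + 2 * c / M).
  rewrite -subr_ge0.
  have -> : (M - c) / M * (1 + 2 * c / M) - 1 = c * (M - 2 * c) / M ^+ 2.
    by field; rewrite gt_eqF.
  by rewrite !mulr_ge0 // ?subr_ge0 // invr_ge0 exprn_ge0 // ltW.
rewrite -(ler_pM2r Mc) (le_trans h) //.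
have -> : k.-1%:R / M * (1 + 2 * c / M) * N E [::] * (M - c) =
  (k.-1%:R * N E [::]) * ((M - c) / M * (1 + 2 * c / M)) by ring.
by rewrite ler_peMr // mulr_ge0.
Qed.

(** The crude bound for error terms and repeated blocks. The 32 in [Tlarge] makes
    [3 k D + 2 |F| <= M / 2] for up to 8 pairs in [F]. *)
Lemma meets_upper2 E F p q : {subset E <= twins} -> p \notin points F ->
  p != q -> (size F <= 8)%N ->
  N E ((p, q) :: F) <= 2 * (k%:R - 1) / M * N E F.
Proof.
move=> EW pF pq F8; have := meets_upper EW pF pq D0.
rewrite -(ler_nat R) !natrM natrB ?natrM; last by nia.
rewrite -/M -/(N E F) -/(N E _) kB1 => h.
have hM : M / 2 <= M - (3 * k * D + 2 * size F)%:R.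
  rewrite natrD !natrM.
  have : (size F)%:R <= 8 :> R by rewrite ler_nat.
  move: Tlarge_real; lra.
have M2 : 0 < M / 2 by rewrite divr_gt0.
rewrite -(ler_pM2r M2).
apply: le_trans (le_trans (ler_wpM2l _ hM) h) _ => //.
have -> : 2 * k.-1%:R / M * N E F * (M / 2) = k.-1%:R * N E F.
  by field; rewrite gt_eqF.
by [].
Qed.

(** A failure of the exchange forces coincidences, which [meets_upper2] controls. At most [D] twins
    [x] cost a relative loss [2 k D / M]; at most [M D] pairs [(r, s)], with two coincidences each,
    cost [4 k D / M]. Hence the 6. *)
Lemma meets_lower1 E p q : {subset E <= twins} ->
  (p, q) \notin E -> (q, p) \notin E -> p != q ->
  (k%:R - 1) / M * (1 - 6 * k%:R * D%:R / M) * N E [::] <= N E [:: (p, q)].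
Proof.
move=> EW h1 h2 pq; have := meets_lower EW h1 h2 pq.
rewrite -(ler_nat R) !(natrD, natrM) !natr_sum -/M -/(N E _) -/(N E _).
set s1 := \sum_(x | _) _; set s2 := \sum_(r | _) _ => h.
have k0 : 0 <= k%:R - 1 :> R by rewrite kB1.
have N0 F : 0 <= N E F by [].
have b1 : s1 <= D%:R * (2 * (k%:R - 1) / M * N E [::]).
  apply: (@le_trans _ _ (\sum_(x | vx x == vx p) (2 * (k%:R - 1) / M * N E [::]))).
    rewrite [leRHS](bigID (fun x => (x != p) && (x != q))) /= -[leLHS]addr0 lerD //.
      by apply: ler_sum => x /and3P[_ _ xq]; apply: meets_upper2.
    by apply: sumr_ge0 => x _; rewrite !mulr_ge0 // invr_ge0 ltW.
  rewrite sumr_const -[leLHS]mulr_natl ler_wpM2r //.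
    by rewrite !mulr_ge0 // invr_ge0 ltW.
  by rewrite ler_nat -(cardsE (fun x => vx x == vx p)) vxD.
have b2 : s2 <= M * (D%:R * (2 * (k%:R - 1) / M * (2 * (k%:R - 1) / M * N E [::]))).
  set B := D%:R * _.
  have B0 : 0 <= B by rewrite !mulr_ge0 // invr_ge0 ltW.
  apply: (@le_trans _ _ (\sum_(r : T) B)); last by rewrite sumr_const -mulr_natl.
  rewrite [leRHS](bigID (fun r => (r != p) && (r != q))) /= -[leLHS]addr0 lerD //;
    last by apply: sumr_ge0.
  apply: ler_sum => r /andP[rp rq]; rewrite natr_sum.
  set b := _ * (_ * N E [::]) in B B0 *.
  have b0 : 0 <= b by rewrite !mulr_ge0 // invr_ge0 ltW.
  apply: (@le_trans _ _ (\sum_(s | vx s == vx r) b)); last first.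
    by rewrite sumr_const -[leLHS]mulr_natl ler_wpM2r // ler_nat -(cardsE (fun x => vx x == vx r)) vxD.
  rewrite [leRHS](bigID (fun s => (s != p) && (s != r))) /= -[leLHS]addr0 lerD //;
    last by apply: sumr_ge0.
  apply: ler_sum => s /and3P[_ sp sr].
  apply: le_trans (meets_upper2 (p := r) (q := q) (F := [:: (s, p)]) EW _ rq isT) _.
    by rewrite !inE /= negb_or eq_sym sr.
  by rewrite /b ler_wpM2l ?mulr_ge0 ?invr_ge0 ?(ltW M0) //; apply: meets_upper2.
rewrite -(ler_pM2l M0).
rewrite -kB1 in h.
have e : M * ((k%:R - 1) / M * (1 - 6 * k%:R * D%:R / M) * N E [::]) =
  (k%:R - 1) * N E [::] - (k%:R - 1) * (D%:R * (2 * k%:R / M * N E [::]))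
   - (k%:R - 1) * (4 * D%:R * k%:R / M * N E [::]) by field; rewrite gt_eqF.
rewrite e.
have c1 : (k%:R - 1) * s1 <= (k%:R - 1) * (D%:R * (2 * k%:R / M * N E [::])).
  rewrite ler_wpM2l // (le_trans b1) // ler_wpM2l // ler_wpM2r // ler_wpM2r ?invr_ge0 ?(ltW M0) //.
  by rewrite ler_wpM2l //; lra.
have c2 : s2 <= (k%:R - 1) * (4 * D%:R * k%:R / M * N E [::]).
  apply: (le_trans b2).
  have -> : M * (D%:R * (2 * (k%:R - 1) / M * (2 * (k%:R - 1) / M * N E [::]))) =
    (k%:R - 1) * (4 * D%:R * (k%:R - 1) / M * N E [::]) by field; rewrite gt_eqF.
  rewrite ler_wpM2l // ler_wpM2r // ler_wpM2r ?invr_ge0 ?(ltW M0) //.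
  by rewrite ler_wpM2l ?mulr_ge0 //; lra.
lra.
Qed.

(** Each potential loop once, as an ordered pair. *)
Definition half_twins : {set T * T} :=
  [set e in twins | (enum_rank e.1 < enum_rank e.2)%N].

Lemma constrained_cons E p q :
  N ((p, q) :: E) [::] = N E [::] - N E [:: (p, q)].
Proof.
apply/esym/eqP; rewrite subr_eq -natrD eqr_nat; apply/eqP.
rewrite -(cardsID [set g : {ffun T -> 'I_m} | g p == g q] (constrained E [::])) addnC.
by congr addn; apply: eq_card => g; rewrite !inE /= !andbT; case: (g p == g q);
  rewrite ?andbF ?andbT.
Qed.

(** At [s = 1] and [s = -1] these are the two bounds for the conditional probability that the next
    pair is a loop. *)
Definition loop_rate (s : R) := (k%:R - 1) / M * (1 + s * (6 * k%:R * D%:R / M)).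

(** The chain rule: each new pair removes a fraction between the two loop rates of what is left.
    Working in [half_twins] guarantees that the reversed pair is not yet in [E], as [meets_lower1]
    requires. *)
Lemma avoids_bounds E : uniq E -> {subset E <= half_twins} ->
  (1 - loop_rate 1) ^+ size E * N [::] [::] <= N E [::] <= (1 - loop_rate (-1)) ^+ size E * N [::] [::].
Proof.
have k0 : 0 <= k%:R - 1 :> R by rewrite kB1.
have k6 : k%:R <= k%:R * D%:R :> R by rewrite ler_peMr // ler1n.
have km1 : (k%:R - 1) / M <= 2^-1.
  rewrite ler_pdivrMr //; move: Tlarge_real; lra.
have d1 : 6 * k%:R * D%:R / M <= 1.
  rewrite ler_pdivrMr // mul1r; move: Tlarge_real; lra.
have d0 : 0 <= 6 * k%:R * D%:R / M by rewrite !mulr_ge0 // invr_ge0 ltW.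
have km0 : 0 <= (k%:R - 1) / M by rewrite mulr_ge0 // invr_ge0 ltW.
have y1 : 0 <= 1 - loop_rate 1 by rewrite /loop_rate; nra.
have y2 : 0 <= 1 - loop_rate (-1) by rewrite /loop_rate; nra.
elim: E => [|[p q] E IH] /=; first by rewrite !mul1r !lexx.
case/andP=> pqE uE EW.
have EH : {subset E <= half_twins} by move=> e eE; apply: EW; rewrite inE eE orbT.
have EW' : {subset E <= twins} by move=> e /EH; rewrite inE => /andP[].
have := EW (p, q); rewrite mem_head => /(_ isT); rewrite !inE /= => /andP[/andP[_ pq] rpq].
have qpE : (q, p) \notin E.
  by apply/negP => /EH; rewrite inE /= => /andP[_ rqp]; move: rpq; rewrite ltnNge ltnW.
have /andP[l u] := IH uE EH.
rewrite constrained_cons !exprS -!mulrA.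
have U := meets_upper1 EW' pq; have L := meets_lower1 EW' pqE qpE pq.
rewrite -[1 + _]/(1 + _) in U.
have Uy : N E [:: (p, q)] <= loop_rate 1 * N E [::] by rewrite /loop_rate mul1r.
have Ly : loop_rate (-1) * N E [::] <= N E [:: (p, q)] by rewrite /loop_rate mulN1r.
apply/andP; split.
  apply: le_trans (ler_wpM2l y1 l) _; lra.
apply: le_trans (ler_wpM2l y2 u); lra.
Qed.

(** Leaves are attached one at a time. The leaf is the point that gets exchanged, so it must be new
    to the constraints, while the centre [p0] may occur in them. The bound 9 leaves at most 8
    constraints before the last leaf. *)
Lemma meets_star E F p0 A : {subset E <= twins} -> uniq (p0 :: A) ->
  {in A, forall a, a \notin points F} -> (size A + size F <= 9)%N ->
  N E ([seq (a, p0) | a <- A] ++ F) <= (2 * k%:R / M) ^+ size A * N E F.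
Proof.
move=> EW; elim: A => [|a A IH]; first by rewrite mul1r.
move=> /= /and3P[]; rewrite inE negb_or => /andP[p0a p0A] aA uA AF sz.
have szA : (size A + size F <= 8)%N by rewrite -ltnS.
apply: le_trans (meets_upper2 EW _ _ _) _ => //.
- rewrite mem_cat /unzip1 /unzip2 !map_cat -!map_comp /=.
  have := AF a (mem_head _ _); rewrite mem_cat !negb_or => /andP[aF1 aF2].
  rewrite !mem_cat !negb_or aF1 aF2 !andbT /= map_id aA /=.
  by apply: contra p0a => /mapP[x _ ->].
- by rewrite eq_sym.
- by rewrite size_cat size_map.
have q0 : 0 <= 2 * k%:R / M by rewrite !mulr_ge0 // invr_ge0 ltW.
rewrite exprS -[leRHS]mulrA.
have h : N E ([seq (a, p0) | a <- A] ++ F) <= (2 * k%:R / M) ^+ size A * N E F.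
  apply: IH; rewrite /= ?p0A ?uA //; last exact: leq_trans szA _.
  by move=> x xA; apply: AF; rewrite inE xA orbT.
apply: le_trans _ (ler_wpM2l q0 h).
rewrite ler_wpM2r // ler_wpM2r ?invr_ge0 ?(ltW M0) //; lra.
Qed.

(** * Repeated blocks *)

Definition edge (g : {ffun T -> 'I_m}) (j : 'I_m) : {set V} := [set vx p | p in T & g p == j].

Definition loopfree := constrained (enum half_twins) [::].

Lemma loopfreeP g : reflect
  (g \in regular /\ forall p q, vx p = vx q -> g p = g q -> p = q) (g \in loopfree).
Proof.
rewrite [g \in loopfree]inE /= andbT; apply: (iffP andP) => -[gG h]; split=> //.
  move=> p q vpq gpq; apply/eqP/negPn/negP => pq.
  have [lt|gt|/val_inj/enum_rank_inj/eqP] := ltngtP (enum_rank p) (enum_rank q); last by rewrite (negPf pq).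
  - have := allP h (p, q); rewrite mem_enum !inE /= vpq eqxx pq lt gpq eqxx.
    by move/(_ isT).
  - have := allP h (q, p); rewrite mem_enum !inE /= vpq eqxx eq_sym pq gt gpq eqxx.
    by move/(_ isT).
apply/allP => -[p q]; rewrite mem_enum !inE /= -andbA => /and3P[/eqP vpq pq _].
by apply: contra pq => /eqP gpq; apply/eqP/h.
Qed.

Definition repeating := [set g in loopfree | ~~ injectiveb (edge g)].

(** If [g] meets [bistar e0 s], the first components of [e0 :: s] share a block,
    and so do the second ones: two blocks have [size s + 1] vertices in common. *)
Definition bistar (e0 : T * T) (s : seq (T * T)) :=
  [seq (a, e0.1) | a <- unzip1 s] ++ [seq (a, e0.2) | a <- unzip2 s] ++ [::].

Lemma half_twins_sub : {subset enum half_twins <= twins}.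
Proof. by move=> e; rewrite mem_enum inE => /andP[]. Qed.

Lemma constrained_bistar e0 s : uniq (e0.1 :: unzip1 s ++ e0.2 :: unzip2 s) ->
  (size s <= 4)%N ->
  N (enum half_twins) (bistar e0 s) <=
  (2 * k%:R / M) ^+ (2 * size s) * #|loopfree|%:R.
Proof.
rewrite cons_uniq mem_cat negb_or cat_uniq => /andP[/andP[n1 _] /and3P[u1 d u2]] s4.
have q0 : 0 <= 2 * k%:R / M by rewrite !mulr_ge0 // invr_ge0 ltW.
have h2 : N (enum half_twins) ([seq (a, e0.2) | a <- unzip2 s] ++ [::]) <=
    (2 * k%:R / M) ^+ size s * #|loopfree|%:R.
  rewrite -(size_map snd s); apply: meets_star => //; first exact: half_twins_sub.
  by rewrite size_map addn0 (leq_trans s4).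
apply: le_trans (meets_star half_twins_sub _ _ _) _.
- by rewrite /= n1.
- move=> a aA; rewrite cats0 /points /unzip1 /unzip2 -!map_comp mem_cat negb_or.
  have {d} : a \notin e0.2 :: unzip2 s.
    by apply: contra d => da; apply/hasP; exists a.
  rewrite inE negb_or => /andP[d1 d2]; apply/andP; split.
    by apply: contra d2 => /mapP[x xs ->]; apply: map_f.
  by apply: contra d1 => /mapP[x _ ->].
- by rewrite cats0 !size_map (leq_trans (leq_add s4 s4)).
by rewrite size_map mul2n -addnn exprD -[leRHS]mulrA ler_wpM2l ?exprn_ge0.
Qed.

(** Take [t + 1 <= k] points of one of two blocks with equal vertex sets and pair each with its twin
    in the other block; without loops the twins are distinct. The first pair supplies the two
    centres, the others the leaves. *)
Lemma repeating_bistar t g : (t < k)%N -> g \in repeating ->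
  exists e0 (w : {ffun 'I_t -> T * T}),
    [/\ e0 \in twins, w \in ffun_on (mem twins),
        uniq (e0.1 :: unzip1 (codom w) ++ e0.2 :: unzip2 (codom w))
      & g \in constrained (enum half_twins) (bistar e0 (codom w))].
Proof.
move=> tk; rewrite inE => /andP[gL].
case/injectivePn => i [j ij eij].
have [gG lf] := loopfreeP g gL.
have sz : size (enum [set p | g p == i]) = k.
  by rewrite -cardE; move: gG; rewrite inE => /forallP /(_ i) /eqP.
set A := enum _ in sz.
(* The default is never reached for points of block [i]: equal vertex sets provide a twin in block
   [j]. *)
pose f p := odflt p [pick q | (g q == j) && (vx q == vx p)].
have fP p : g p == i -> g (f p) = j /\ vx (f p) = vx p.
  move=> gp; rewrite /f; case: pickP => [q /andP[/eqP ? /eqP ?] //|h].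
  have : vx p \in edge g j by rewrite -eij; apply/imsetP; exists p => //; rewrite inE.
  case/imsetP => q; rewrite inE => /= gq vq; have := h q.
  by rewrite gq vq eqxx.
have AP p : (p \in A) = (g p == i) by rewrite mem_enum inE.
have finj : {in A &, injective f}.
  move=> p q; rewrite !AP => gp gq fpq; apply: lf; last by rewrite (eqP gp) (eqP gq).
  by have [_ <-] := fP p gp; have [_ <-] := fP q gq; rewrite fpq.
have uA : uniq A by exact: enum_uniq.
case: A sz AP uA finj => [|p0 A] /= sz AP uA finj; first by rewrite -sz in tk.
pose w : {ffun 'I_t -> T * T} := [ffun i : 'I_t => (nth p0 A i, f (nth p0 A i))].
have tA : (t <= size A)%N by rewrite -ltnS sz.
have cw : codom w = [seq (a, f a) | a <- take t A].
  have -> : take t A = [seq nth p0 A (i : 'I_t) | i <- enum 'I_t].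
    by rewrite -(map_nth_iota0 p0 tA) -val_enum_ord -map_comp.
  by rewrite codomE -map_comp; apply: eq_map => l; rewrite /= ffunE.
have c1 : unzip1 (codom w) = take t A by rewrite cw /unzip1 -map_comp map_id.
have c2 : unzip2 (codom w) = map f (take t A) by rewrite cw /unzip2 -map_comp.
have sA : {subset take t A <= A} by exact: mem_take.
have gA p : p \in p0 :: take t A -> g p == i.
  by rewrite -AP !inE => /orP[->|/sA ->] //; rewrite orbT.
have tw p : p \in p0 :: take t A -> (p, f p) \in twins.
  move=> /gA gp; have [gf vf] := fP p gp; rewrite inE /= vf eqxx /=.
  by apply: contra ij => /eqP e; rewrite -(eqP gp) -gf -e.
exists (p0, f p0), w; split.
- by apply: tw; rewrite mem_head.
- apply/ffun_onP => x; have : w x \in codom w by apply: codom_f.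
  rewrite cw => /mapP[a aA ->]; apply: tw; by rewrite inE aA orbT.
- rewrite c1 c2; change (is_true (uniq ((p0 :: take t A) ++ map f (p0 :: take t A)))).
  rewrite cat_uniq.
  have uB : uniq (p0 :: take t A).
    by case/andP: uA => h1 h2; rewrite /= take_uniq // (contra (sA _) h1).
  rewrite uB map_inj_in_uniq ?uB ?andbT; last first.
    by move=> x y /gA hx /gA hy; apply: finj; rewrite AP.
  apply/hasPn => x /mapP[y /gA hy ->]; apply/negP => /gA hx.
  by have [gf _] := fP y hy; move: ij; rewrite -(eqP hx) gf eqxx.
- move: gL; rewrite inE => /and3P[_ gE _].
  rewrite inE gG gE /= /bistar cats0 c1 c2 /meets all_cat; apply/andP; split.
    apply/allP => _ /mapP[a aA ->] /=; apply/eqP.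
    by rewrite (eqP (gA p0 (mem_head _ _))) (eqP (gA a _)) // inE aA orbT.
  apply/allP => _ /mapP[_ /mapP[a aA ->] ->] /=; apply/eqP.
  have [-> _] := fP p0 (gA p0 (mem_head _ _)).
  by have [|-> _] := fP a => //; apply: gA; rewrite inE aA orbT.
Qed.

(** A union bound: [t + 1] twin pairs can be chosen in at most [(M D)^(t+1)] ways, and they impose
    [2 t] coincidences. Each further common vertex gains a factor of order [k^2 D / M], so [t = 2],
    the largest value allowed for [k = 3], gives order [D^3 / m], and [t = 3] gives order
    [k^4 D^4 / m^2]. *)
Lemma card_repeating t : (t < k)%N -> (t <= 4)%N ->
  #|repeating|%:R <= (M * D%:R) ^+ t.+1 * (2 * k%:R / M) ^+ (2 * t) * #|loopfree|%:R :> R.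
Proof.
move=> tk t4.
pose B : R := (2 * k%:R / M) ^+ (2 * t) * #|loopfree|%:R.
pose u e0 (w : {ffun 'I_t -> T * T}) :=
  uniq (e0.1 :: unzip1 (codom w) ++ e0.2 :: unzip2 (codom w)).
apply: (@le_trans _ _ (\sum_(e0 in twins) \sum_(w in ffun_on (mem twins))
   (if u e0 w then N (enum half_twins) (bistar e0 (codom w)) else 0))).
  have -> : #|repeating|%:R = \sum_(g in repeating) 1 :> R by rewrite sumr_const.
  rewrite (eq_bigr (fun e0 => \sum_(w in ffun_on (mem twins)) \sum_g
     (u e0 w && (g \in constrained (enum half_twins) (bistar e0 (codom w))))%:R)); last first.
    move=> e0 _; apply: eq_bigr => w _; case: ifP => _ /=; last by rewrite big1.
    rewrite /N -natr_sum; congr _%:R; rewrite -sum1_card [LHS]big_mkcond.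
    by apply: eq_bigr => g _; case: ifP.
  under eq_bigr do rewrite exchange_big /=.
  rewrite exchange_big /= big_mkcond /=; apply: ler_sum => g _.
  case: ifP => [gR|_]; last by rewrite !sumr_ge0 // => e _; rewrite sumr_ge0.
  have [e0 [w [e0T wT uw gw]]] := repeating_bistar tk gR.
  rewrite (bigD1 e0) //= (bigD1 w) //= /u uw gw /= -addrA lerDl addr_ge0 //.
    by rewrite sumr_ge0.
  by rewrite sumr_ge0 // => e _; rewrite sumr_ge0.
have B0 : 0 <= B by rewrite mulr_ge0 // exprn_ge0 // !mulr_ge0 // invr_ge0 ltW.
apply: (@le_trans _ _ (\sum_(e0 in twins) \sum_(w in ffun_on (mem twins) : {pred {ffun 'I_t -> T * T}}) B)).
  apply: ler_sum => e0 _; apply: ler_sum => w _; case: ifP => // uw.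
  have sw : size (codom w) = t by rewrite size_codom card_ord.
  by have := constrained_bistar uw; rewrite sw; apply.
rewrite !sumr_const card_ffun_on card_ord -mulrnA -expnSr -[leLHS]mulr_natl -[leRHS]mulrA -/B ler_wpM2r //.
by rewrite -natrM -natrX ler_nat leq_exp2r // card_twins.
Qed.
End Bounds.
End Switching.

(** * Counting configurations *)

(** Uniqueness of the zipped list is injectivity on each fiber of [s]. A new head at [v] must avoid
    the [count_mem v s] distinct values already taken by [v] in the tail, which adds one factor to
    the falling factorial of [v]. *)
Lemma card_injective_on_fibers_tuple (V J : finType) (A : V -> {set J}) (s : seq V) N :
  size s = N ->
  #|[set t : N.-tuple J | uniq (zip s t) && all (fun x => x.2 \in A x.1) (zip s t)]|
  = (\prod_v #|A v| ^_ (count_mem v s))%N.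
Proof.
elim: s N => [|v s IH] [|N] //= => [_|[sN]].
  rewrite big1 => [|v _]; last by rewrite ffactn0.
  rewrite (_ : [set t | _] = setT) ?cardsT ?card_tuple //.
  by apply/setP => -[[|//] i]; rewrite !inE.
pose P N' (s' : seq V) (t : N'.-tuple J) :=
  uniq (zip s' t) && all (fun x => x.2 \in A x.1) (zip s' t).
rewrite -sum1dep_card.
rewrite (reindex (fun jt : J * N.-tuple J => cons_tuple jt.1 jt.2)) /=; last first.
  exists (fun t : N.+1.-tuple J => (thead t, [tuple of behead t])) => [[j t] _|t _] /=.
    by congr pair; apply: val_inj.
  by apply: val_inj; rewrite [in RHS](tuple_eta t).
rewrite (eq_bigl (fun jt => P N s jt.2 &&
   (jt.1 \in A v :\: [set x | (v, x) \in zip s jt.2]))); last first.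
  case=> j t; rewrite /P !inE /=.
  by case: (_ \in zip _ _); case: (uniq _); case: (j \in _); rewrite ?andbF ?andbT.
transitivity (\sum_(t : N.-tuple J | P N s t)
  \sum_(j in A v :\: [set x | (v, x) \in zip s t]) 1)%N.
  rewrite pair_big_dep /= (reindex (fun x : N.-tuple J * J => (x.2, x.1))) //=.
  by exists (fun x => (x.2, x.1)) => -[].
transitivity (\sum_(t : N.-tuple J | P N s t) (#|A v| - count_mem v s))%N.
  apply: eq_bigr => t /andP[ut /allP At]; rewrite sum1_card cardsD; congr subn.
  pose z := [seq x.2 | x <- zip s t & x.1 == v].
  have zP x : (x \in z) = ((v, x) \in zip s t).
    apply/mapP/idP => [[[w y]]|h]; first by rewrite mem_filter /= => /andP[/eqP -> ?] ->.
    by exists (v, x); rewrite ?mem_filter //= eqxx.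
  have uz : uniq z.
    rewrite map_inj_in_uniq ?filter_uniq // => -[a b] [c e].
    by rewrite !mem_filter /= => /andP[/eqP -> _] /andP[/eqP -> _] ->.
  transitivity #|z|.
    apply: eq_card => x; rewrite !inE -zP andb_idl // zP => h.
    by have := At _ h.
  rewrite (card_uniqP uz) size_map size_filter.
  by rewrite -(count_map fst (pred1 v)) -/(unzip1 _) unzip1_zip ?size_tuple ?sN ?leqnn.
rewrite sum_nat_cond_const (IH N sN).
rewrite (bigD1 v) //= [RHS](bigD1 v) //= eqxx add1n ffactnSr.
rewrite mulnAC; congr muln; apply: eq_bigr => w wv.
by rewrite eq_sym (negPf wv).
Qed.

(** Serves twice: with blocks as fibers, to number the points inside a block, and with vertices as
    fibers, to deal the points of a vertex to its edges. *)
Lemma card_injective_on_fibers (T V J : finType) (vx : T -> V) (A : V -> {set J}) :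
  #|[set g : {ffun T -> J} | [forall p, g p \in A (vx p)] &&
      [forall p, forall q, (vx p == vx q) && (g p == g q) ==> (p == q)]]|
  = (\prod_v #|A v| ^_ #|[set p | vx p == v]|)%N.
Proof.
have sz : size [seq vx p | p <- enum T] = #|T| by rewrite size_map -cardE.
transitivity (\prod_v #|A v| ^_ (count_mem v [seq vx p | p <- enum T]))%N; last first.
  apply: eq_bigr => v _; congr falling_factorial.
  by rewrite count_map -sum1_count big_enum_cond sum1dep_card; apply: eq_card.
rewrite -(card_injective_on_fibers_tuple A sz).
rewrite -(card_imset _ (can_inj (@fgraphK T J))).
apply: eq_card => t.
have zE (g : {ffun T -> J}) :
    zip [seq vx p | p <- enum T] (fgraph g) = [seq (vx p, g p) | p <- enum T].
  by rewrite -codom_ffun codomE zip_map.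
apply/imsetP/idP => [[g]|].
  rewrite inE => /andP[/forallP gA /forallP gi] ->; rewrite inE zE; apply/andP; split.
    rewrite map_inj_uniq ?enum_uniq // => p q [vpq gpq]; apply/eqP.
    by have /forallP/(_ q) := gi p; rewrite vpq gpq !eqxx.
  by apply/allP => _ /mapP[p _ ->] /=.
move=> tP; exists (Finfun t); last by rewrite FinfunK.
move: tP; rewrite -{1}(FinfunK t) !inE zE; set g := Finfun t => /andP[u /allP a].
apply/andP; split.
  by apply/forallP => p; apply: (a (vx p, g p)); apply: (map_f (fun p => (vx p, g p))); rewrite mem_enum.
apply/forallP => p; apply/forallP => q; apply/implyP => /andP[/eqP vpq /eqP gpq].
have np x : nth (vx p, g p) [seq (vx p, g p) | p <- enum T] (index x (enum T)) = (vx x, g x).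
  by rewrite (nth_map p) ?index_mem ?mem_enum // nth_index ?mem_enum.
have /(_ (index p (enum T)) (index q (enum T))) := uniqP (vx p, g p) u.
rewrite !inE size_map !index_mem !mem_enum !np vpq gpq => /(_ isT isT erefl) ipq.
by rewrite -(nth_index p (mem_enum T p)) ipq nth_index ?mem_enum.
Qed.

(** Injections of [T] into block-and-position pairs are counted by their block part [g]. A regular
    [g] extends in [k!^m] ways; any other has a block with more than [k] points, since the sizes sum
    to [m k], and does not extend. *)
Lemma card_regular (T : finType) (k m : nat) : #|T| = (m * k)%N ->
  (#|regular T k m| * k`! ^ m = #|T|`!)%N.
Proof.
move=> TE.
have -> : (#|T|`! = #|[set f : {ffun T -> 'I_m * 'I_k} | injectiveb f]|)%N.
  by rewrite card_inj_ffuns card_prod !card_ord -TE ffactnn.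
pose S (gf : {ffun T -> 'I_m} * {ffun T -> 'I_k}) :=
  [forall p, forall q, (gf.1 p == gf.1 q) && (gf.2 p == gf.2 q) ==> (p == q)].
pose pairing (gf : {ffun T -> 'I_m} * {ffun T -> 'I_k}) : {ffun T -> 'I_m * 'I_k} :=
  [ffun p => (gf.1 p, gf.2 p)].
have pairing_bij : bijective pairing.
  exists (fun f : {ffun T -> 'I_m * 'I_k} => ([ffun p => (f p).1], [ffun p => (f p).2])).
    by case=> g f; congr pair; apply/ffunP => p; rewrite !ffunE.
  by move=> f; apply/ffunP => p; rewrite !ffunE; case: (f p).
rewrite -[RHS]sum1dep_card (reindex pairing) /=; last exact: onW_bij.
rewrite (eq_bigl S); last first.
  move=> [g f]; apply/injectiveP/forallP => [inj p|h p q].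
    apply/forallP => q; apply/implyP => /andP[/= /eqP gpq /eqP fpq].
    by apply/eqP/inj; rewrite !ffunE /= gpq fpq.
  rewrite !ffunE /= => -[gpq fpq]; have /forallP/(_ q) := h p.
  by rewrite /= gpq fpq !eqxx => /eqP.
rewrite -(pair_big_dep xpredT (fun g f => S (g, f)) (fun _ _ => 1%N)) /=.
rewrite -sum_nat_const big_mkcond /=; apply: eq_bigr => g _.
transitivity (\prod_(j < m) k ^_ #|[set p | g p == j]|)%N; last first.
  rewrite sum1dep_card; have := card_injective_on_fibers g (fun _ => [set: 'I_k]).
  under eq_bigr do rewrite cardsT card_ord.
  move=> <-; apply: eq_card => f; rewrite !inE.
  have -> : [forall p, f p \in [set: 'I_k]] by apply/forallP => p; rewrite inE.
  by [].
case: ifPn => [|nreg].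
  rewrite inE => /forallP reg; rewrite (eq_bigr (fun _ => k`!)); last first.
    by move=> j _; rewrite (eqP (reg j)) ffactnn.
  by rewrite prod_nat_const card_ord.
have fib : (\sum_(j < m) #|[set p | g p == j]| = \sum_(j < m) k)%N.
  rewrite sum_nat_const card_ord -TE -sum1_card (partition_big g xpredT) //=.
  by apply: eq_bigr => j _; rewrite sum1dep_card.
have /exists_inP [j _ jk] : [exists j in 'I_m, k < #|[set p | g p == j]|].
  apply: contraR nreg => /exists_inPn h; rewrite inE; apply/forallP => j.
  have le i : (#|[set p | g p == i]| <= k)%N by rewrite leqNgt h.
  have := leqif_sum (P := xpredT) (fun i _ => leqif_eq (le i)).
  by rewrite fib /= => -[_]; rewrite eqxx => /esym/forallP/(_ j).
by rewrite (bigD1 j) //= ffact_small.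
Qed.

(** * Simple configurations versus k-graphs *)

Section SimpleConfigurations.
Variables (n k m : nat) (d : 'I_n -> nat) (T : finType) (vx : T -> 'I_n).
Hypothesis vxd : forall v, #|[set p | vx p == v]| = d v.

Definition simple_configs := [set g in loopfree vx k m | injectiveb (edge vx g)].

Let kgraphs_deg : {set {set {set 'I_n}}} := [set G | [&& is_kgraph k G, #|G| == m &
        [forall v, Posz (deg G v) == Posz (d v)]]].

Let labelings : {set {ffun 'I_m -> {set 'I_n}}} :=
  [set f : {ffun 'I_m -> {set 'I_n}} | injectiveb f && ([set f j | j : 'I_m] \in kgraphs_deg)].

Lemma card_labelings : #|labelings| = (num_kgraphs_deg k m (fun v => Posz (d v)) * m`!)%N.
Proof.
rewrite /num_kgraphs_deg -/kgraphs_deg -sum_nat_const -sum1_card.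
rewrite (partition_big (fun f : {ffun 'I_m -> {set 'I_n}} => [set f j | j : 'I_m]) (mem kgraphs_deg)) /=; last first.
  by move=> f; rewrite inE => /andP[].
apply: eq_bigr => H HK.
have Hm : #|H| = m by move: HK; rewrite inE => /and3P[_ /eqP].
have := card_inj_ffuns_on 'I_m (mem H); rewrite card_ord -[#|mem H|]/#|H| Hm ffactnn => <-.
rewrite sum1dep_card; apply: eq_card => f; rewrite !inE; apply/andP/andP => -[].
  case/andP=> fi _ /eqP fH; split=> //; apply/ffun_onP => j.
  by rewrite -fH imset_f.
move=> /ffun_onP fH fi.
have e : [set f j | j : 'I_m] = H.
  apply/eqP; rewrite eqEcard; apply/andP; split.
    by apply/subsetP => _ /imsetP[j _ ->]; apply: fH.
  by rewrite card_imset ?card_ord ?Hm //; apply/injectiveP.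
by move: HK; rewrite inE e fi => ->.
Qed.

Lemma deg_labeling (f : {ffun 'I_m -> {set 'I_n}}) v : injective f ->
  deg [set f j | j : 'I_m] v = #|[set j | v \in f j]|.
Proof.
move=> fi; rewrite /deg -(card_imset _ fi); apply: eq_card => e; rewrite inE.
apply/andP/imsetP => [[/imsetP[j _ ->] vj]|[j + ->]]; first by exists j; rewrite ?inE.
by rewrite inE imset_f.
Qed.

Lemma mem_edge (g : {ffun T -> 'I_m}) j v :
  reflect (exists2 p, vx p = v & g p = j) (v \in edge vx g j).
Proof.
apply: (iffP imsetP) => [[p]|[p <- gp]]; first by rewrite inE => /= /eqP gp ->; exists p.
by exists p => //; rewrite inE /= gp.
Qed.

Lemma card_edge (g : {ffun T -> 'I_m}) j :
  (forall p q, vx p = vx q -> g p = g q -> p = q) ->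
  #|edge vx g j| = #|[set p | g p == j]|.
Proof.
move=> lf; rewrite /edge card_in_imset; first by apply: eq_card => p; rewrite !inE.
by move=> p q; rewrite !inE /= => /eqP gp /eqP gq vpq; apply: lf; rewrite // gp.
Qed.

Lemma card_block_of_fiber (g : {ffun T -> 'I_m}) v :
  (forall p q, vx p = vx q -> g p = g q -> p = q) ->
  #|[set j | v \in edge vx g j]| = d v.
Proof.
move=> lf; rewrite -vxd -(card_in_imset (f := g) (D := mem [set p | vx p == v])); last first.
  by move=> p q; rewrite !inE => /eqP vp /eqP vq; apply: lf; rewrite vp.
apply: eq_card => j; rewrite inE; apply/mem_edge/imsetP => [[p vp gp]|[p + ->]].
  by exists p; rewrite ?inE ?vp.
by rewrite inE => /eqP vp; exists p.
Qed.

Lemma simple_labeling g : g \in simple_configs -> [ffun j => edge vx g j] \in labelings.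
Proof.
rewrite inE => /andP[/loopfreeP[gG lf] /injectiveP gi].
have fi : injective [ffun j => edge vx g j] by move=> i j; rewrite !ffunE; apply: gi.
rewrite inE; apply/andP; split; first exact/injectiveP.
rewrite inE; apply/and3P; split.
- apply/forallP => e; apply/implyP => /imsetP[j _ ->]; rewrite ffunE card_edge //.
  by move: gG; rewrite inE => /forallP.
- by rewrite card_imset // card_ord.
- apply/forallP => v; rewrite deg_labeling // -(card_block_of_fiber v lf) eqz_nat.
  by apply/eqP/eq_card => j; rewrite !inE ffunE.
Qed.

(** The points of [v] are dealt injectively to the [d v] edges containing [v], independently for
    each vertex. Conversely such a deal is onto those edges, both sides having [d v] elements, so
    its blocks have exactly the prescribed vertex sets. *)
Lemma card_simple_of_labeling f : f \in labelings ->
  #|[set g in simple_configs | [ffun j => edge vx g j] == f]| = (\prod_v (d v)`!)%N.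
Proof.
rewrite inE => /andP[/injectiveP fi fK].
have degf v : #|[set j | v \in f j]| = d v.
  move: fK; rewrite inE => /and3P[_ _ /forallP/(_ v)].
  by rewrite deg_labeling // => /eqP[].
have cardf j : #|f j| = k.
  move: fK; rewrite inE => /and3P[/forallP/(_ (f j)) + _ _].
  by rewrite imset_f // => /eqP.
rewrite (eq_bigr (fun v => #|[set j | v \in f j]| ^_ #|[set p | vx p == v]|)%N); last first.
  by move=> v _; rewrite degf vxd ffactnn.
rewrite -card_injective_on_fibers; apply: eq_card => g.
rewrite [LHS]in_set [in LHS]in_set [RHS]in_set; apply/andP/andP => -[].
  move=> /andP[/loopfreeP[_ lf] _] /eqP ef; split; apply/forallP => p.
    by rewrite -ef inE ffunE; apply/mem_edge; exists p.
  by apply/forallP => q; apply/implyP => /andP[/eqP vpq /eqP gpq]; apply/eqP/lf.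
move=> /forallP gA /forallP gi.
have lf p q : vx p = vx q -> g p = g q -> p = q.
  move=> vpq gpq; apply/eqP; have /forallP/(_ q) := gi p.
  by rewrite vpq gpq !eqxx.
have ef j : edge vx g j = f j.
  apply/setP => v.
  have /setP/(_ j) : [set j | v \in edge vx g j] = [set j | v \in f j].
    apply/eqP; rewrite eqEcard (card_block_of_fiber v lf) degf leqnn andbT.
    apply/subsetP => i; rewrite !inE => /mem_edge[p <- <-].
    by have := gA p; rewrite inE.
  by rewrite !inE.
split; last by apply/eqP/ffunP => j; rewrite ffunE.
apply/andP; split; last by apply/injectiveP => i j; rewrite !ef; apply: fi.
apply/loopfreeP; split=> //; rewrite inE; apply/forallP => j.
by rewrite -(card_edge j lf) ef cardf.
Qed.

Lemma card_simple :
  #|simple_configs| = (num_kgraphs_deg k m (fun v => Posz (d v)) * m`! * \prod_v (d v)`!)%N.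
Proof.
rewrite -card_labelings -sum_nat_const -sum1_card.
rewrite (partition_big (fun g => [ffun j => edge vx g j]) (mem labelings)) /=; last first.
  exact: simple_labeling.
by apply: eq_bigr => f fL; rewrite sum1dep_card -(card_simple_of_labeling fL); apply: eq_card => g; rewrite !inE.
Qed.
End SimpleConfigurations.

Local Open Scope ring_scope.

(** * Elementary estimates *)

Section Estimates.
Variable R : realType.
Implicit Types (x : R) (n k a N : nat).

(** From [(1 - x) (1 + x + 2 x^2) = 1 + x^2 (1 - 2 x) >= 1]. *)
Lemma expR_le_1B x : 0 <= x -> x <= 2^-1 -> expR (- (x + 2 * x ^+ 2)) <= 1 - x.
Proof.
move=> x0 x2; rewrite expRN -[leRHS]invrK lef_pV2 ?posrE ?expR_gt0 ?invr_gt0 //; last by lra.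
apply: le_trans (expR_ge1Dx _); rewrite -[leLHS]mul1r ler_pdivrMr; last by lra.
rewrite -subr_ge0; nra.
Qed.

Lemma expR_le_1Dx x : 0 <= x -> expR x <= 1 + x * expR x.
Proof.
move=> x0; have := expR_ge1Dx (- x); rewrite expRN => h.
have e0 := expR_gt0 x.
have : (1 - x) * expR x <= (expR x)^-1 * expR x by rewrite ler_wpM2r // ltW.
by rewrite mulVf ?gt_eqF //; lra.
Qed.

(** With [z = i / N], each factor [1 - z] lies between [exp(- z - 2 z^2)] and [exp(- z)]; the
    quadratic terms sum to at most [2 a^3 / N^2]. *)
Lemma ffact_bounds N a : (2 * a <= N)%N -> (0 < N)%N ->
  N%:R ^+ a * expR (- (a%:R * (a%:R - 1) / (2 * N%:R) + 2 * a%:R ^+ 3 / N%:R ^+ 2))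
    <= (N ^_ a)%:R :> R /\
  (N ^_ a)%:R <= N%:R ^+ a * expR (- (a%:R * (a%:R - 1) / (2 * N%:R))) :> R.
Proof.
move=> + N0; have N0' : (0 : R) < N%:R by rewrite ltr0n.
elim: a => [|a IH] aN.
  by rewrite ffactn0 !mul0r expr0n /= mulr0 !mul0r addr0 oppr0 expR0 !mul1r lexx.
have /IH [l u] : (2 * a <= N)%N by lia.
have aNR : 2 * a%:R + 2 <= N%:R :> R by rewrite -natrM -natrD ler_nat; lia.
have a0 : 0 <= a%:R :> R by [].
pose z : R := a%:R / N%:R.
have z0 : 0 <= z by rewrite divr_ge0.
have z2 : z <= 2^-1 by rewrite ler_pdivrMr //; lra.
have step : (N ^_ a.+1)%:R = (N ^_ a)%:R * (N%:R * (1 - z)) :> R.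
  rewrite ffactnSr natrM natrB; last by lia.
  by congr *%R; rewrite /z; field; rewrite gt_eqF.
rewrite step exprSr -natr1; set A := N%:R ^+ a in l u *.
have A0 : 0 <= A by rewrite exprn_ge0.
have z1 : 0 <= 1 - z by lra.
have sum1 : (a%:R + 1) * (a%:R + 1 - 1) / (2 * N%:R) = a%:R * (a%:R - 1) / (2 * N%:R) + z.
  by rewrite /z; field; rewrite gt_eqF.
split.
  have zz := expR_le_1B z0 z2.
  apply: (@le_trans _ _ ((A * expR (- (a%:R * (a%:R - 1) / (2 * N%:R) + 2 * a%:R ^+ 3 / N%:R ^+ 2)))
     * (N%:R * (1 - z)))); last by rewrite ler_wpM2r // mulr_ge0.
  rewrite -[leLHS]mulrA -[leRHS]mulrA ler_wpM2l // [leRHS]mulrCA ler_wpM2l // ?ler0n //.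
  apply: le_trans (ler_wpM2l (expR_ge0 _) zz); rewrite -expRD ler_expR sum1.
  have -> : 2 * (a%:R + 1) ^+ 3 / N%:R ^+ 2 =
    2 * a%:R ^+ 3 / N%:R ^+ 2 + 2 * z ^+ 2 + (4 * a%:R ^+ 2 + 6 * a%:R + 2) / N%:R ^+ 2.
    by rewrite /z; field; rewrite gt_eqF.
  have : 0 <= (4 * a%:R ^+ 2 + 6 * a%:R + 2) / N%:R ^+ 2 :> R.
    by rewrite divr_ge0 ?exprn_ge0 // !addr_ge0 // ?mulr_ge0 ?exprn_ge0.
  lra.
apply: (le_trans (ler_wpM2r _ u)); first by rewrite mulr_ge0.
rewrite -[leLHS]mulrA -[leRHS]mulrA ler_wpM2l // [leLHS]mulrCA ler_wpM2l // ?ler0n //.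
apply: le_trans (ler_wpM2l (expR_ge0 _) (expR_ge1Dx _)) _.
by rewrite -expRD ler_expR sum1; lra.
Qed.

(** For the places where the first-order term is itself an error; the sharper form is kept for
    [n ^_ k], whose first-order term enters the answer. *)
Lemma ffact_bounds_simple N a : (2 * a <= N)%N -> (0 < N)%N ->
  N%:R ^+ a * expR (- (2 * a%:R ^+ 2 / N%:R)) <= (N ^_ a)%:R :> R /\
  (N ^_ a)%:R <= N%:R ^+ a :> R.
Proof.
move=> aN N0; have [l u] := ffact_bounds aN N0.
have N0' : (0 : R) < N%:R by rewrite ltr0n.
have A0 : 0 <= N%:R ^+ a :> R by rewrite exprn_ge0.
have aNR : 2 * a%:R <= N%:R :> R by rewrite -natrM ler_nat.
have [a1|a1] : a%:R = 0 :> R \/ 1 <= a%:R :> R.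
  by case: (a) => [|b]; [left | right; rewrite ler1n].
- have -> : a = 0%N by apply/eqP; rewrite -(eqr_nat R) a1.
  by rewrite ffactn0 !expr0 expr0n /= mulr0 mul0r oppr0 expR0 mulr1 lexx.
split.
  apply: le_trans l; rewrite ler_wpM2l // ler_expR lerN2.
  have -> : a%:R * (a%:R - 1) / (2 * N%:R) + 2 * a%:R ^+ 3 / N%:R ^+ 2 =
     (a%:R * (a%:R - 1) * N%:R / 2 + 2 * a%:R ^+ 3) / N%:R ^+ 2 :> R.
    by field; rewrite gt_eqF.
  have -> : 2 * a%:R ^+ 2 / N%:R = 2 * a%:R ^+ 2 * N%:R / N%:R ^+ 2 :> R.
    by field; rewrite gt_eqF.
  rewrite ler_pM2r ?invr_gt0 ?exprn_gt0 //.
  have h1 : 2 * a%:R ^+ 3 <= a%:R ^+ 2 * N%:R :> R.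
    by rewrite exprSr mulrCA ler_wpM2l ?exprn_ge0.
  have h2 : a%:R * (a%:R - 1) * N%:R <= a%:R ^+ 2 * N%:R :> R.
    by rewrite ler_wpM2r // expr2 ler_wpM2l //; lra.
  have h3 : 0 <= a%:R ^+ 2 * N%:R :> R by rewrite mulr_ge0 ?exprn_ge0.
  lra.
apply: (le_trans u); rewrite ler_piMr // expR_le1 oppr_le0 divr_ge0 ?mulr_ge0 //; lra.
Qed.

(** Absorption peels off the factor [(a+1)/(b+1) >= c], and [c >= 1] preserves the hypothesis for
    [a] and [b]. *)
Lemma bin_ge_pow (c : R) a b : 1 <= c -> c * b%:R <= a%:R -> c ^+ b <= 'C(a, b)%:R.
Proof.
move=> c1; elim: b a => [|b IH] a; first by rewrite bin0.
case: a => [|a].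
  move=> h; have : (0 : R) < c * b.+1%:R by rewrite mulr_gt0 ?ltr0n //; lra.
  by rewrite ltNge h.
move=> h; have b0 : (0 : R) < b.+1%:R by rewrite ltr0n.
rewrite -(ler_pM2l b0) -[leRHS]natrM -mul_bin_diag natrM /= exprS mulrA [b.+1%:R * c]mulrC.
have cb : c ^+ b <= 'C(a, b)%:R by apply: IH; move: h; rewrite -!natr1; lra.
by apply: ler_pM => //; rewrite ?exprn_ge0 ?mulr_ge0 //; lra.
Qed.
End Estimates.

(** * The ratio of the two probabilities *)

Lemma card_half_twins (T V : finType) (vx : T -> V) :
  (2 * #|half_twins vx| = #|twins vx|)%N.
Proof.
rewrite -(cardsID [set e | (enum_rank e.1 < enum_rank e.2)%N] (twins vx)) mul2n -addnn.
have half_I : half_twins vx =i twins vx :&: [set e | (enum_rank e.1 < enum_rank e.2)%N].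
  by move=> e; rewrite !inE.
congr addn; first exact: eq_card.
pose sw (e : T * T) := (e.2, e.1).
have swK : involutive sw by case.
rewrite -(card_imset _ (can_inj swK)); apply: eq_card => e.
rewrite -[in RHS](swK e) (mem_imset _ _ (can_inj swK)) half_I !inE /= ltnNge leq_eqVlt negb_or.
rewrite (inj_eq (@ord_inj _)) (inj_eq enum_rank_inj) [vx e.2 == _]eq_sym [e.2 == e.1]eq_sym.
by case: (vx _ == _); case: (e.1 == e.2); rewrite ?andbF ?andbT.
Qed.

Lemma card_twins_fibers (T V : finType) (vx : T -> V) :
  (#|twins vx| + #|T| = \sum_v #|[set p | vx p == v]| ^ 2)%N.
Proof.
transitivity (\sum_(p : T) #|[set q | vx q == vx p]|)%N.
  rewrite -sum1_card -[#|T|]sum1_card.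
  rewrite (eq_bigl (fun e => (vx e.1 == vx e.2) && (e.1 != e.2))); last by move=> e; rewrite inE.
  rewrite -(pair_big_dep xpredT (fun p q => (vx p == vx q) && (p != q)) (fun _ _ => 1%N)) /=.
  rewrite -big_split /=; apply: eq_bigr => p _.
  rewrite (cardsD1 p) inE eqxx addnC; congr addn.
  by rewrite sum1dep_card; apply: eq_card => q; rewrite !inE andbC [vx p == _]eq_sym [p == q]eq_sym.
rewrite (partition_big vx xpredT) //=; apply: eq_bigr => v _.
rewrite -[(_ ^ 2)%N]/(_ * _)%N -sum_nat_const big_mkcond [RHS]big_mkcond /=.
by apply: eq_bigr => p _; rewrite inE; case: eqP => // ->.
Qed.

Section Ratio.
Variables (R : realType) (n k m D : nat) (d : 'I_n -> nat) (T : finType) (vx : T -> 'I_n).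
Hypothesis vxd : forall v, #|[set p | vx p == v]| = d v.
Hypothesis dD : forall v, (d v <= D)%N.
Hypothesis cardT : #|T| = (k * m)%N.
Hypotheses (D0 : (0 < D)%N) (k2 : (2 < k)%N) (kn : (2 * k <= n)%N).
Hypothesis Tlarge : (6 * k * D + 32 <= #|T|)%N.
Let B := 'C(n.-1, k.-1).
Hypothesis DB : (2 * D <= B)%N.

Let M : R := #|T|%:R.
Let E := 'C(n, k).
Let h : R := #|half_twins vx|%:R.
(** The leading loop exponent, followed by three error exponents: [del] from the loops, [tau] from
    the falling factorials of [B], [E] and [n * B], and [xi] from the [m]-th power of [n ^_ k]. *)
Let lam : R := (k%:R - 1) / M * h.
Let del : R := k%:R * D%:R ^+ 2 / m%:R.
Let tau : R := D%:R * M / B%:R.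
Let xi : R := 2 * m%:R * k%:R ^+ 3 / n%:R ^+ 2.
Let L : {set {ffun T -> 'I_m}} := loopfree vx k m.

Let vxD v : (#|[set p | vx p == v]| <= D)%N.
Proof. by rewrite vxd. Qed.
Let k1 : (1 < k)%N.
Proof. exact: ltnW. Qed.
Let M0 : 0 < M.
Proof. by rewrite ltr0n; lia. Qed.
Let m0 : (0 < m)%N.
Proof. by case: m cardT Tlarge => // ->; rewrite muln0; lia. Qed.
Let MR : M = k%:R * m%:R.
Proof. by rewrite /M cardT natrM. Qed.
Let kR0 : 0 < k%:R :> R.
Proof. by rewrite ltr0n; lia. Qed.
Let mR0 : 0 < m%:R :> R.
Proof. by rewrite ltr0n. Qed.
Let DR1 : 1 <= D%:R :> R.
Proof. by rewrite ler1n. Qed.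
Let MlargeR : 6 * k%:R * D%:R + 32 <= M.
Proof. by rewrite -!natrM -natrD ler_nat. Qed.

Let h2 : h * 2 <= M * D%:R.
Proof.
rewrite -!natrM ler_nat mulnC card_half_twins.
exact: card_twins.
Qed.

(** The relative error of the loop rate contributes [3 del] on either side. The lower bound pays
    [4 del] more for the quadratic term of [expR_le_1B]. *)
Lemma loopfree_ratio :
  expR (- (lam + 7 * del)) * #|regular T k m|%:R <= #|L|%:R :> R /\
  #|L|%:R <= expR (- lam + 3 * del) * #|regular T k m|%:R :> R.
Proof.
have uh : uniq (enum (half_twins vx)) by exact: enum_uniq.
have sh : {subset enum (half_twins vx) <= half_twins vx} by move=> e; rewrite mem_enum.
have /andP[] /= := avoids_bounds m vxD R D0 k1 Tlarge uh sh.
have -> : constrained (T := T) k m [::] [::] = regular T k m.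
  by apply/setP => g; rewrite !inE /= andbT.
rewrite -cardE -/L => lo up.
have c0 : 0 <= h by [].
have k10 : 0 <= k%:R - 1 :> R by rewrite subr_ge0 ler1n ltnW.
pose e : R := 6 * k%:R * D%:R / M.
have e0 : 0 <= e by rewrite divr_ge0 ?mulr_ge0 // ltW.
have e1 : e <= 1 by rewrite ler_pdivrMr // mul1r; move: MlargeR; lra.
have de : del = k%:R ^+ 2 * D%:R ^+ 2 / M.
  by rewrite /del MR; field; rewrite !gt_eqF.
have lame : lam * e <= 3 * del.
  have -> : lam * e = (h * 2) * ((k%:R - 1) * 3 * k%:R * D%:R / M ^+ 2).
    by rewrite /lam /e; field; rewrite gt_eqF.
  have -> : 3 * del = (M * D%:R) * (k%:R * 3 * k%:R * D%:R / M ^+ 2).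
    by rewrite de; field; rewrite gt_eqF.
  apply: ler_pM => //; first by rewrite mulr_ge0.
    by rewrite divr_ge0 ?exprn_ge0 // ?mulr_ge0 // ltW.
  rewrite ler_wpM2r ?invr_ge0 ?exprn_ge0 ?(ltW M0) //.
  by do 3![rewrite ler_wpM2r //]; lra.
have step z : expR (h * z) = expR z ^+ #|half_twins vx| by rewrite -expRM_natl.
split.
  apply: le_trans lo; rewrite ler_wpM2r //.
  set y := loop_rate _ _ _ _.
  have yE : y = (k%:R - 1) / M * (1 + e) by rewrite /y /loop_rate mul1r.
  have kM : (k%:R - 1) / M <= 6^-1.
    rewrite ler_pdivrMr //; move: MlargeR.
    have : k%:R <= k%:R * D%:R :> R by rewrite ler_peMr // ltW.
    lra.
  have kM0 : 0 <= (k%:R - 1) / M by rewrite divr_ge0 // ltW.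
  have y0 : 0 <= y by rewrite yE; nra.
  have y2 : y <= 2^-1 by rewrite yE; nra.
  apply: le_trans (_ : expR (h * (- (y + 2 * y ^+ 2))) <= _); last first.
    by rewrite step lerXn2r ?nnegrE ?expR_ge0 ?expR_le_1B //; lra.
  rewrite ler_expR mulrN lerN2 mulrDr.
  have -> : h * y = lam + lam * e by rewrite yE /lam; ring.
  have : h * (2 * y ^+ 2) <= 4 * del.
    have yk : y <= 2 * (k%:R / M).
      rewrite yE.
      have : (k%:R - 1) / M <= k%:R / M by rewrite ler_wpM2r ?invr_ge0 ?(ltW M0) //; lra.
      nra.
    have y2k : y ^+ 2 <= (2 * (k%:R / M)) ^+ 2.
      by rewrite lerXn2r ?nnegrE // mulr_ge0 // divr_ge0 // ltW.
    have -> : h * (2 * y ^+ 2) = (h * 2) * y ^+ 2 by ring.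
    apply: (@le_trans _ _ (M * D%:R * (2 * (k%:R / M)) ^+ 2)).
      by apply: ler_pM => //; [apply: mulr_ge0 | apply: exprn_ge0].
    have -> : M * D%:R * (2 * (k%:R / M)) ^+ 2 = 4 * (k%:R ^+ 2 * D%:R / M).
      by field; rewrite gt_eqF.
    rewrite de ler_wpM2l // ler_wpM2r ?invr_ge0 ?(ltW M0) // ler_wpM2l ?exprn_ge0 //.
    by rewrite expr2 ler_peMr.
  lra.
apply: (le_trans up); rewrite ler_wpM2r //.
set y := loop_rate _ _ _ _.
have yE : y = (k%:R - 1) / M * (1 - e) by rewrite /y /loop_rate mulN1r.
apply: (@le_trans _ _ (expR (h * - y))).
  rewrite step lerXn2r ?nnegrE ?expR_ge0 ?expR_ge1Dx //.
  have kM : (k%:R - 1) / M <= 1.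
    rewrite ler_pdivrMr //; move: MlargeR.
    have : k%:R <= k%:R * D%:R :> R by rewrite ler_peMr // ltW.
    lra.
  have kM0 : 0 <= (k%:R - 1) / M by rewrite divr_ge0 // ltW.
  rewrite yE; nra.
rewrite ler_expR.
have -> : h * - y = - lam + lam * e by rewrite yE /lam; ring.
by rewrite lerD2l.
Qed.

Let dz v := Posz (d v).
Let S : {set {ffun T -> 'I_m}} := simple_configs k m vx.
Let X : R := m%:R * (k%:R * (k%:R - 1) / (2 * n%:R)).
Let main : R := PrB R k m dz *
  expR ((k%:R - 1) / 2 * (1 - n%:R * sigma2 R k m dz / (k * m)%:R)).
Let dfact : R := \prod_v (d v)`!%:R.

Let nR0 : 0 < n%:R :> R.
Proof. by rewrite ltr0n (leq_trans _ kn) // muln_gt0 (ltnW k1). Qed.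
Let sumd : (\sum_v d v = k * m)%N.
Proof.
rewrite -cardT -sum1_card (partition_big vx xpredT) //=.
by apply: eq_bigr => v _; rewrite sum1dep_card -vxd.
Qed.
Let sumd2 : \sum_v (d v)%:R ^+ 2 = h * 2 + M :> R.
Proof.
rewrite -natrM -natrD mulnC card_half_twins card_twins_fibers natr_sum.
by apply: eq_bigr => v _; rewrite vxd natrX.
Qed.
Let dfact0 : 0 < dfact.
Proof. by apply: prodr_gt0 => v _; rewrite ltr0n fact_gt0. Qed.

Lemma num_kgraphsE : num_kgraphs n k m = 'C(E, m).
Proof.
rewrite /num_kgraphs /E -[in RHS](card_ord n) -card_draws -cards_draws.
apply: eq_card => G; rewrite !inE; congr andb.
by apply/forall_inP/subsetP => H e /H; rewrite inE.
Qed.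

Lemma PrDE : PrD R k m dz = #|S|%:R / (dfact * (E ^_ m)%:R).
Proof.
rewrite /PrD num_kgraphsE /S (card_simple k m vxd) !natrM natr_prod -/dfact -bin_ffact natrM.
have m1 : (m`!)%:R != 0 :> R by rewrite pnatr_eq0 -lt0n fact_gt0.
have [->|c0] := eqVneq ('C(E, m)%:R : R) 0; first by rewrite mul0r mulr0 invr0 !mulr0.
by field; rewrite c0 m1 gt_eqF.
Qed.

Lemma mainE : main = (#|T|`!)%:R / ((n * B) ^_ #|T|)%:R *
  (\prod_v (B ^_ d v)%:R / dfact) * expR (X - lam).
Proof.
rewrite /main /PrB -/B -cardT; congr (_ * _ * expR _).
- rewrite -bin_ffact natrM invfM mulrCA divff ?mulr1 //.
  by rewrite pnatr_eq0 -lt0n fact_gt0.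
- rewrite /dfact -prodf_div; apply: eq_bigr => v _ /=.
  by rewrite -bin_ffact natrM mulfK // pnatr_eq0 -lt0n fact_gt0.
rewrite /sigma2 -cardT -/M.
have -> : \sum_(v < n) ((dz v)%:~R - M / n%:R) ^+ 2 = h * 2 + M - M ^+ 2 / n%:R.
  transitivity (\sum_(v < n) ((d v)%:R ^+ 2 + ((- 2 * (M / n%:R)) * (d v)%:R + (M / n%:R) ^+ 2))).
    by apply: eq_bigr => v _; rewrite /dz -pmulrn; ring.
  rewrite !big_split /= sumd2 -mulr_sumr -natr_sum sumd -cardT -/M sumr_const card_ord -mulr_natl.
  by field; rewrite gt_eqF.
have MX : X = (k%:R - 1) * M / (2 * n%:R) by rewrite /X MR; field; rewrite gt_eqF.
by rewrite MX /lam; field; rewrite !gt_eqF.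
Qed.

Let B0 : (0 < B)%N.
Proof. by apply: leq_trans DB; rewrite muln_gt0. Qed.
Let BR0 : 0 < B%:R :> R.
Proof. by rewrite ltr0n. Qed.
Let MnD : (#|T| <= n * D)%N.
Proof.
rewrite cardT -sumd -[n in X in (_ <= X)%N]card_ord -sum_nat_const.
exact: leq_sum.
Qed.
Let nBE : (n * B = k * E)%N.
Proof. by rewrite /B /E; have := mul_bin_diag n k.-1; rewrite prednK // ltnW. Qed.
Let E0 : (0 < E)%N.
Proof. by rewrite bin_gt0 (leq_trans _ kn) // leq_pmull. Qed.
Let T_le_nB : (2 * #|T| <= n * B)%N.
Proof. by rewrite (leq_trans (leq_mul (leqnn 2) MnD)) // mulnCA leq_mul2l DB orbT. Qed.
Let nB0 : (0 < n * B)%N.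
Proof. by rewrite muln_gt0 B0 andbT -(ltr0n R). Qed.
Let mE : (2 * m <= E)%N.
Proof. by rewrite -(leq_pmul2l (ltnW k1)) mulnCA -cardT -nBE. Qed.

(** The loss [2 M^2 / (n B)] is at most [2 tau] because [M <= n D]. The same budget suffices for
    [E], through [k E = n B], and for the product over vertices, through [sum_v d_v^2 <= D M]. *)
Let nB_bounds : (n * B)%:R ^+ #|T| * expR (- (2 * tau)) <= ((n * B) ^_ #|T|)%:R :> R /\
  ((n * B) ^_ #|T|)%:R <= (n * B)%:R ^+ #|T| :> R.
Proof.
have [] := @ffact_bounds_simple R (n * B) #|T|; [exact: T_le_nB | exact: nB0 | ].
move=> l u; split=> //; apply: le_trans l; rewrite ler_wpM2l ?exprn_ge0 //.
rewrite ler_expR lerN2 -mulrA ler_wpM2l // -/M /tau natrM.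
rewrite ler_pdivrMr ?mulr_gt0 //.
have -> : D%:R * M / B%:R * (n%:R * B%:R) = M * (n%:R * D%:R) by field; rewrite gt_eqF.
by rewrite expr2 ler_wpM2l ?(ltW M0) // -natrM ler_nat.
Qed.

Let E_bounds : E%:R ^+ m * expR (- (2 * tau)) <= (E ^_ m)%:R :> R /\
  (E ^_ m)%:R <= E%:R ^+ m :> R.
Proof.
have [] := @ffact_bounds_simple R E m; [by [] | by [] | ].
move=> l u; split=> //; apply: le_trans l; rewrite ler_wpM2l ?exprn_ge0 //.
rewrite ler_expR lerN2 -mulrA ler_wpM2l // /tau.
have ER0 : 0 < E%:R :> R by rewrite ltr0n.
have EE : E%:R = n%:R * B%:R / k%:R :> R.
  by rewrite -natrM nBE natrM; field; rewrite gt_eqF.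
rewrite ler_pdivrMr // EE.
have -> : D%:R * M / B%:R * (n%:R * B%:R / k%:R) = m%:R * (n%:R * D%:R) :> R.
  by rewrite MR; field; rewrite !gt_eqF.
by rewrite expr2 ler_wpM2l // -natrM ler_nat (leq_trans _ MnD) // cardT leq_pmull // (ltnW k1).
Qed.

Let B_bounds : B%:R ^+ #|T| * expR (- (2 * tau)) <= \prod_v (B ^_ d v)%:R :> R /\
  \prod_v (B ^_ d v)%:R <= B%:R ^+ #|T| :> R.
Proof.
have Bd v : B%:R ^+ d v * expR (- (2 * (d v)%:R ^+ 2 / B%:R)) <= (B ^_ d v)%:R :> R /\
    (B ^_ d v)%:R <= B%:R ^+ d v :> R.
  by apply: ffact_bounds_simple => //; rewrite (leq_trans _ DB) // leq_mul2l dD.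
have -> : B%:R ^+ #|T| = \prod_v B%:R ^+ d v :> R.
  by rewrite cardT -sumd prodrXr.
split; last by apply: ler_prod => v _; rewrite ler0n; case: (Bd v).
apply: (@le_trans _ _ (\prod_v (B%:R ^+ d v * expR (- (2 * (d v)%:R ^+ 2 / B%:R))))).
  rewrite big_split /= ler_wpM2l //; first by apply: prodr_ge0 => v _; rewrite exprn_ge0.
  rewrite -expR_sum ler_expR sumrN lerN2 -mulr_suml -mulr_sumr -mulrA ler_wpM2l //.
  rewrite /tau ler_wpM2r ?invr_ge0 // -/M /M cardT -sumd natr_sum mulr_sumr.
  by apply: ler_sum => v _; rewrite expr2 ler_wpM2r // ler_nat.
apply: ler_prod => v _; rewrite mulr_ge0 ?exprn_ge0 ?expR_ge0 //.
by case: (Bd v).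
Qed.

Let Ek_bounds : n%:R ^+ #|T| * expR (- (X + xi)) <= k`!%:R ^+ m * E%:R ^+ m :> R /\
  k`!%:R ^+ m * E%:R ^+ m <= n%:R ^+ #|T| * expR (- X) :> R.
Proof.
have [|l u] := @ffact_bounds R n k kn; first by rewrite -(ltr0n R).
rewrite -exprMn -natrM mulnC bin_ffact cardT exprM.
have -> : expR (- X) = expR (- (k%:R * (k%:R - 1) / (2 * n%:R))) ^+ m.
  by rewrite -expRM_natl mulrN.
have -> : expR (- (X + xi)) =
    expR (- (k%:R * (k%:R - 1) / (2 * n%:R) + 2 * k%:R ^+ 3 / n%:R ^+ 2)) ^+ m.
  by rewrite -expRM_natl mulrN; congr expR; congr (- _); rewrite /X /xi; ring.
rewrite -!exprMn; split; rewrite lerXn2r ?nnegrE ?mulr_ge0 ?exprn_ge0 ?expR_ge0 //.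
Qed.

Let regularE : (#|T|`!)%:R = #|regular T k m|%:R * k`!%:R ^+ m :> R.
Proof. by rewrite -natrX -natrM card_regular // cardT mulnC. Qed.

Let ff_gt0 : 0 < ((n * B) ^_ #|T|)%:R :> R /\ 0 < (E ^_ m)%:R :> R.
Proof.
have le2 a b : (2 * a <= b -> a <= b)%N by apply: leq_trans; rewrite leq_pmull.
by rewrite !ltr0n !ffact_gt0; split; apply: le2.
Qed.

Let S_le_L : #|S|%:R <= #|L|%:R :> R.
Proof. by rewrite ler_nat subset_leq_card //; apply/subsetP => g; rewrite inE => /andP[]. Qed.

(** The costs are [3 del] for loops, [2 tau] each for [E ^_ m] and the product of the [B ^_ d v],
    and [xi] for [n ^_ k]; [(n * B) ^_ #|T|] is replaced by a plain power without loss. *)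
Lemma PrD_upper : PrD R k m dz <= expR (3 * del + 4 * tau + xi) * main.
Proof.
rewrite PrDE mainE; have [f1 f2] := ff_gt0.
rewrite ler_pdivrMr ?mulr_gt0 //.
set G := expR (_ + _ + _); set P := \prod_v _; set F := ((n * B) ^_ _)%:R.
have -> : G * ((#|T|`!)%:R / F * (P / dfact) * expR (X - lam)) * (dfact * (E ^_ m)%:R)
   = (G * (#|T|`!)%:R * P * expR (X - lam) * (E ^_ m)%:R) / F.
  by field; rewrite !gt_eqF.
rewrite ler_pdivlMr //.
have [_ L2] := loopfree_ratio.
apply: (@le_trans _ _ (expR (- lam + 3 * del) * #|regular T k m|%:R * (n * B)%:R ^+ #|T|)).
  by apply: ler_pM => //; [exact: le_trans S_le_L L2 | case: nB_bounds].
have -> : (n * B)%:R ^+ #|T| =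
  expR (X + xi) * (n%:R ^+ #|T| * expR (- (X + xi))) *
  (expR (2 * tau) * (B%:R ^+ #|T| * expR (- (2 * tau)))) :> R.
  by rewrite natrM exprMn !expRN; field; rewrite !gt_eqF ?expR_gt0.
have [e1 _] := Ek_bounds; have [b1 _] := B_bounds; have [E1 _] := E_bounds.
rewrite regularE.
have -> : G = expR (- lam + 3 * del) * expR (X + xi) * expR (2 * tau) * expR (2 * tau) / expR (X - lam).
  by rewrite -expRN -!expRD /G; congr expR; ring.
have -> : expR (- lam + 3 * del) * expR (X + xi) * expR (2 * tau) * expR (2 * tau) / expR (X - lam)
   * (#|regular T k m|%:R * k`!%:R ^+ m) * P * expR (X - lam) * (E ^_ m)%:R =
  (expR (- lam + 3 * del) * #|regular T k m|%:R) * (expR (X + xi) * (k`!%:R ^+ m * (expR (2 * tau) * (E ^_ m)%:R)) * (expR (2 * tau) * P)).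
  by field; rewrite gt_eqF ?expR_gt0.
rewrite ler_wpM2l //; first by rewrite mulr_ge0 ?expR_ge0.
apply: ler_pM => //.
- by rewrite !mulr_ge0 ?exprn_ge0 ?expR_ge0.
- by rewrite !mulr_ge0 ?exprn_ge0 ?expR_ge0.
- rewrite ler_wpM2l ?expR_ge0 // (le_trans e1) // ler_wpM2l ?exprn_ge0 //.
  by rewrite mulrC -ler_pdivrMr ?expR_gt0 // -expRN.
- by rewrite ler_wpM2l ?expR_ge0.
Qed.

(** Roles are reversed: besides the loops only [(n * B) ^_ #|T|] costs anything, namely [2 tau].
    Here [rho] bounds the proportion of loop-free configurations with a repeated block. *)
Lemma PrD_lower (rho : R) : (1 - rho) * #|L|%:R <= #|S|%:R ->
  (1 - rho) * expR (- (7 * del + 2 * tau)) * main <= PrD R k m dz.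
Proof.
move=> hrho.
have main0 : 0 <= main.
  rewrite mainE !mulr_ge0 ?expR_ge0 ?invr_ge0 ?(ltW dfact0) //.
  by apply: prodr_ge0.
have [r1|r1] := leP (1 - rho) 0.
  apply: (@le_trans _ _ 0); last by rewrite /PrD divr_ge0.
  by rewrite -mulrA mulr_le0_ge0 // mulr_ge0 ?expR_ge0.
rewrite PrDE mainE; have [f1 f2] := ff_gt0.
rewrite ler_pdivlMr ?mulr_gt0 //.
set G := expR (- (_ + _)); set P := \prod_v _; set F := ((n * B) ^_ _)%:R.
have -> : (1 - rho) * G * ((#|T|`!)%:R / F * (P / dfact) * expR (X - lam)) * (dfact * (E ^_ m)%:R)
   = ((1 - rho) * G * (#|T|`!)%:R * P * expR (X - lam) * (E ^_ m)%:R) / F.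
  by field; rewrite !gt_eqF.
rewrite ler_pdivrMr //.
have [L1 _] := loopfree_ratio.
have [_ e1] := Ek_bounds; have [_ b1] := B_bounds; have [_ E1] := E_bounds.
have [N1 _] := nB_bounds.
apply: (@le_trans _ _ ((1 - rho) * (expR (- (lam + 7 * del)) * #|regular T k m|%:R) *
   ((n * B)%:R ^+ #|T| * expR (- (2 * tau))))); last first.
  apply: ler_pM => //.
  - by rewrite !mulr_ge0 ?expR_ge0 // ltW.
  - by rewrite mulr_ge0 ?expR_ge0 ?exprn_ge0.
  - by apply: le_trans hrho; rewrite ler_wpM2l // ltW.
rewrite regularE.
have -> : G = expR (- (lam + 7 * del)) * expR (- (2 * tau)) * expR lam.
  by rewrite -!expRD /G; congr expR; ring.
have -> : expR (X - lam) = expR X / expR lam by rewrite -expRN -expRD.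
have -> : (1 - rho) * (expR (- (lam + 7 * del)) * expR (- (2 * tau)) * expR lam) *
    (#|regular T k m|%:R * k`!%:R ^+ m) * P * (expR X / expR lam) * (E ^_ m)%:R =
  (1 - rho) * (expR (- (lam + 7 * del)) * #|regular T k m|%:R) * expR (- (2 * tau)) *
  ((expR X * (k`!%:R ^+ m * (E ^_ m)%:R)) * P).
  by field; rewrite gt_eqF ?expR_gt0.
have -> : (1 - rho) * (expR (- (lam + 7 * del)) * #|regular T k m|%:R) *
   ((n * B)%:R ^+ #|T| * expR (- (2 * tau))) =
  (1 - rho) * (expR (- (lam + 7 * del)) * #|regular T k m|%:R) * expR (- (2 * tau)) *
   ((n%:R ^+ #|T|) * B%:R ^+ #|T|) by rewrite natrM exprMn; ring.
rewrite ler_wpM2l //; first by rewrite !mulr_ge0 ?expR_ge0 // ltW.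
apply: ler_pM => //.
- by rewrite !mulr_ge0 ?expR_ge0 ?exprn_ge0.
- by apply: prodr_ge0.
rewrite mulrC -ler_pdivlMr ?expR_gt0 // -expRN (le_trans _ e1) //.
by rewrite ler_wpM2l ?exprn_ge0.
Qed.

Lemma simple_lower t : (t < k)%N -> (t <= 4)%N ->
  (1 - (M * D%:R) ^+ t.+1 * (2 * k%:R / M) ^+ (2 * t)) * #|L|%:R <= #|S|%:R.
Proof.
move=> tk t4; have := card_repeating m vxD R D0 k1 Tlarge tk t4.
have LE : #|L|%:R = #|S|%:R + #|repeating vx k m|%:R :> R.
  rewrite -natrD; congr _%:R.
  rewrite -(cardsID [set g : {ffun T -> 'I_m} | injectiveb (edge vx g)]); congr addn.
    by apply: eq_card => g; rewrite !in_set.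
  by apply: eq_card => g; rewrite !in_set andbC.
rewrite -/M -/L mulrBl mul1r; set c := _ * #|L|%:R => rep_le.
by rewrite lerBlDr LE lerD2l.
Qed.
End Ratio.

(** * The role of psi *)

(** As [16 = 2^4], it is enough that [ln 2 >= 1/2]. The purpose is [ln n ^ 9 >= 512], which together
    with [psi < 1] forces [m] to be large. *)
Lemma ln_ge2 (R : realType) n : (16 <= n)%N -> 2 <= ln (n%:R : R).
Proof.
move=> n16.
have l2 : 2^-1 <= ln (2 : R).
  rewrite -[leLHS]expRK ler_ln ?posrE ?expR_gt0 //.
  rewrite -[_^-1]opprK expRN -[leRHS]invrK lef_pV2 ?posrE ?expR_gt0 ?invr_gt0 //.
  by apply: le_trans (expR_ge1Dx _); lra.
have -> : 2 = 4 * 2^-1 :> R by lra.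
apply: (@le_trans _ _ (ln ((2 : R) ^+ 4))); first by rewrite lnXn // -[leRHS]mulr_natl ler_wpM2l.
by rewrite ler_ln ?posrE ?exprn_gt0 ?ltr0n ?(leq_trans _ n16) // -natrX ler_nat.
Qed.

Section Admissibility.
Variables (R : realType) (n k m D : nat).
Hypotheses (n16 : (16 <= n)%N) (m0 : (0 < m)%N) (D0 : (0 < D)%N).
Hypothesis kmnD : (k * m <= n * D)%N.
Let p := psi R n k m D.
Hypothesis p1 : p < 1.
Let B := 'C(n.-1, k.-1).

(** Size conditions for the ratio estimates, then each error in units of [p]. The constants are
    those of [k = 3], where [t = 2] gives [27 * 16 = 432]; they also cover [k >= 4]. *)
Definition admissible t := [/\ 0 <= p, (2 * k <= n)%N,
  (6 * k * D + 32 <= k * m)%N & (2 * D <= B)%N] /\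
  [/\ (k%:R * D%:R ^+ 2 / m%:R : R) <= 3 * p,
      (D%:R * (k * m)%:R / B%:R : R) <= 3 * p,
      (2 * m%:R * k%:R ^+ 3 / n%:R ^+ 2 : R) <= 6 * p
    & (((k * m)%:R * D%:R) ^+ t.+1 * (2 * k%:R / (k * m)%:R) ^+ (2 * t) : R) <= 432 * p].

Let nR : 16 <= n%:R :> R.
Proof. by rewrite ler_nat. Qed.
Let mR : 0 < m%:R :> R.
Proof. by rewrite ltr0n. Qed.
Let DR : 1 <= D%:R :> R.
Proof. by rewrite ler1n. Qed.
Let kmnDR : k%:R * m%:R <= n%:R * D%:R :> R.
Proof. by rewrite -!natrM ler_nat. Qed.

Let B_ge : (0 < k)%N -> (k <= n)%N -> (n%:R / k%:R) ^+ k.-1 <= B%:R :> R.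
Proof.
move=> k0 kn.
have kR : 0 < k%:R :> R by rewrite ltr0n.
have knR : k%:R <= n%:R :> R by rewrite ler_nat.
apply: bin_ge_pow; first by rewrite ler_pdivlMr ?mul1r.
have -> : n.-1%:R = n%:R - 1 :> R by rewrite -subn1 natrB ?(leq_trans _ n16).
have -> : k.-1%:R = k%:R - 1 :> R by rewrite -subn1 natrB.
have -> : n%:R / k%:R * (k%:R - 1) = n%:R - n%:R / k%:R :> R by field; rewrite gt_eqF.
by rewrite lerD2l lerN2 ler_pdivlMr ?mul1r.
Qed.

Lemma degree_le_half_bin : 0 < B%:R :> R -> (6 <= k * m)%N -> D%:R * (k * m)%:R / B%:R <= 3 :> R -> (2 * D <= B)%N.
Proof.
move=> B0 km; rewrite ler_pdivrMr // => h.
rewrite -(ler_nat R) natrM.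
have : 6 * D%:R <= D%:R * (k * m)%:R :> R by rewrite mulrC ler_wpM2l // ler_nat.
lra.
Qed.

Lemma admissible3 : k = 3%N -> admissible 2.
Proof.
move=> k3; have lt1 : p < 1 := p1; have n16R := nR; have D1R := DR.
have pE : p * m%:R = D%:R ^+ 3 + ln (n%:R : R) ^+ 9.
  by rewrite /p /psi k3 /=; field; rewrite gt_eqF.
have L9 : 512 <= ln (n%:R : R) ^+ 9.
  have -> : 512 = 2 ^+ 9 :> R by rewrite -natrX.
  by rewrite lerXn2r ?nnegrE ?ln_ge2 // (le_trans _ (ln_ge2 _ n16)).
have D30 : 1 <= D%:R ^+ 3 :> R by rewrite exprn_ege1.
have p0 : 0 <= p by rewrite -(pmulr_lge0 _ mR) pE; lra.
have pm : p * m%:R < m%:R by rewrite -[ltRHS]mul1r ltr_pM2r.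
have kR : k%:R = 3 :> R by rewrite k3.
have D0R : 0 < D%:R :> R by lra.
have n0 : 0 < n%:R :> R by lra.
have h3 : D%:R ^+ 3 <= p * m%:R by rewrite pE; lra.
have km : 3 * m%:R <= n%:R * D%:R :> R by rewrite -kR.
(* Combining [D^3 <= p m] with [3 m <= n D] and cancelling [D] trades [m] for [n], the scale of the
   remaining errors. *)
have D2n : 3 * D%:R ^+ 2 <= p * n%:R.
  rewrite -(ler_pM2r D0R) -mulrA -exprSr.
  have : p * (3 * m%:R) <= p * (n%:R * D%:R) by rewrite ler_wpM2l.
  lra.
have D23 : D%:R ^+ 2 <= D%:R ^+ 3 :> R by rewrite [leRHS]exprSr ler_peMr // exprn_ge0.
have D12 : D%:R <= D%:R ^+ 2 :> R by rewrite expr2 ler_peMr // ltW.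
have Tl : (6 * k * D + 32 <= k * m)%N.
  rewrite k3 -(ler_nat R) natrD !natrM.
  have D3 : 6 * D%:R <= D%:R ^+ 3 + 16 :> R.
    have [d3|d3] := leP (D%:R : R) 2; first by lra.
    have : 4 * D%:R <= D%:R ^+ 3 :> R.
      by rewrite exprS mulrC ler_wpM2l ?(ltW D0R) //; nra.
    by nra.
  lra.
have B0 : (n%:R / 3) ^+ 2 <= B%:R :> R.
  have := B_ge _ _; rewrite k3 => /(_ isT); apply; exact: leq_trans n16.
have n30 : 0 < (n%:R / 3) ^+ 2 :> R by rewrite exprn_gt0 // divr_gt0.
have B1 : 0 < B%:R :> R by apply: lt_le_trans B0.
have tau : D%:R * (k * m)%:R / B%:R <= 3 * p :> R.
  rewrite ler_pdivrMr // (le_trans _ (ler_wpM2l _ B0)) ?mulr_ge0 //.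
  rewrite natrM kR.
  apply: (@le_trans _ _ (D%:R * (n%:R * D%:R))); first by rewrite ler_wpM2l // ltW.
  have -> : 3 * p * (n%:R / 3) ^+ 2 = (p * n%:R) / 3 * n%:R by field.
  have -> : D%:R * (n%:R * D%:R) = D%:R ^+ 2 * n%:R :> R by ring.
  by rewrite ler_wpM2r ?(ltW n0) // ler_pdivlMr // mulrC.
split; split=> //.
- by rewrite k3; apply: leq_trans n16.
- apply: degree_le_half_bin => //; first by apply: leq_trans Tl; apply: leq_trans (leq_addl _ 32).
  by apply: (le_trans tau); lra.
- rewrite kR ler_pdivrMr //; lra.
- rewrite kR ler_pdivrMr ?exprn_gt0 //.
  apply: (@le_trans _ _ (18 * (n%:R * D%:R))); first by lra.
  rewrite (_ : 6 * p * n%:R ^+ 2 = n%:R * (6 * (p * n%:R))); last by ring.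
  rewrite mulrCA ler_wpM2l ?(ltW n0) //; lra.
- rewrite natrM kR.
  have -> : (3 * m%:R * D%:R) ^+ 3 * (2 * 3 / (3 * m%:R)) ^+ (2 * 2) = 432 * (D%:R ^+ 3 / m%:R) :> R.
    by field; rewrite gt_eqF.
  by rewrite ler_wpM2l // ler_pdivrMr.
Qed.

Lemma admissible4 : (3 < k)%N -> admissible 3.
Proof.
move=> k4; have lt1 : p < 1 := p1; have n16R := nR; have D1R := DR.
have kR : 4 <= k%:R :> R by rewrite ler_nat.
set x : R := k%:R in kR *.
have x0 : 0 < x by lra.
pose l := ln (n%:R : R).
have l2 : 2 <= l by exact: ln_ge2.
have pE : p * m%:R = x ^+ 2 * (D%:R ^+ 2 + x * D%:R * l ^+ 4 + x ^+ 2 * l ^+ 9).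
  by rewrite /p /psi gtn_eqF // -/l -/x; field; rewrite gt_eqF.
have L9 : 512 <= l ^+ 9.
  have -> : 512 = 2 ^+ 9 :> R by rewrite -natrX.
  by rewrite lerXn2r ?nnegrE // (le_trans _ l2).
have D0R : 0 < D%:R :> R by lra.
have n0 : 0 < n%:R :> R by lra.
have x2 : 16 <= x ^+ 2 by nra.
have mid : 0 <= x * D%:R * l ^+ 4 by rewrite !mulr_ge0 ?exprn_ge0 ?ltW //; lra.
have last1 : 512 <= x ^+ 2 * l ^+ 9.
  have : 1 * 512 <= x ^+ 2 * l ^+ 9 by rewrite ler_pM //; lra.
  lra.
have h2 : x ^+ 2 * D%:R ^+ 2 <= p * m%:R.
  by rewrite pE ler_wpM2l ?exprn_ge0 ?(ltW x0) //; lra.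
have h512 : x ^+ 2 * D%:R ^+ 2 + 512 <= p * m%:R.
  rewrite pE -addrA mulrDr lerD2l.
  have : 1 * 512 <= x ^+ 2 * (x * D%:R * l ^+ 4 + x ^+ 2 * l ^+ 9) by rewrite ler_pM //; lra.
  lra.
have D20 : 0 <= x ^+ 2 * D%:R ^+ 2 by rewrite mulr_ge0 ?exprn_ge0 ?ltW.
have p0 : 0 <= p by rewrite -(pmulr_lge0 _ mR); lra.
have pm : p * m%:R < m%:R by rewrite -[ltRHS]mul1r ltr_pM2r.
have km : x * m%:R <= n%:R * D%:R by [].
have D12 : D%:R <= D%:R ^+ 2 :> R by rewrite expr2 ler_peMr // ltW.
have D2x : 16 * D%:R <= x ^+ 2 * D%:R ^+ 2 by rewrite ler_pM // ltW.
have x3D : x ^+ 3 * D%:R <= p * n%:R.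
  rewrite -(ler_pM2r D0R).
  have : p * (x * m%:R) <= p * (n%:R * D%:R) by rewrite ler_wpM2l.
  have : x * (x ^+ 2 * D%:R ^+ 2) <= x * (p * m%:R) by rewrite ler_wpM2l // ltW.
  have -> : x * (x ^+ 2 * D%:R ^+ 2) = x ^+ 3 * D%:R * D%:R by ring.
  rewrite -[p * n%:R * _]mulrA; lra.
have x30 : 0 <= x ^+ 3 by rewrite exprn_ge0 // ltW.
have x3 : x ^+ 3 <= p * n%:R by apply: le_trans x3D; rewrite ler_peMr.
have pn : p * n%:R <= n%:R by rewrite ler_piMl // ltW.
have x16 : 16 * x <= x ^+ 3 by rewrite [leRHS]exprSr ler_wpM2r // ltW.
have kn : (2 * k <= n)%N by rewrite -(ler_nat R) natrM -/x; lra.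
have Tl : (6 * k * D + 32 <= k * m)%N.
  rewrite -(ler_nat R) natrD !natrM -/x.
  have : x * (6 * D%:R + 8) <= x * m%:R by rewrite ler_wpM2l ?(ltW x0) //; lra.
  lra.
have B0 : (n%:R / x) ^+ 3 <= B%:R.
  have k0 : (0 < k)%N by apply: leq_trans k4.
  have kn' : (k <= n)%N by apply: leq_trans kn; rewrite leq_pmull.
  apply: le_trans (B_ge k0 kn'); rewrite -/x.
  have nx : 1 <= n%:R / x by rewrite ler_pdivlMr // mul1r /x ler_nat.
  by apply: ler_weXn2l => //; rewrite -ltnS prednK.
have nx0 : 0 < (n%:R / x) ^+ 3 by rewrite exprn_gt0 // divr_gt0.
have B1 : 0 < B%:R :> R by apply: lt_le_trans B0.
have tau : D%:R * (k * m)%:R / B%:R <= 3 * p :> R.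
  apply: (@le_trans _ _ p); last by lra.
  rewrite ler_pdivrMr // (le_trans _ (ler_wpM2l _ B0)) //.
  rewrite natrM -/x.
  apply: (@le_trans _ _ (D%:R * (n%:R * D%:R))); first by rewrite ler_wpM2l // ltW.
  rewrite expr_div_n [leRHS]mulrA ler_pdivlMr ?exprn_gt0 //.
  have -> : D%:R * (n%:R * D%:R) * x ^+ 3 = n%:R * (D%:R * (x ^+ 3 * D%:R)) by ring.
  have -> : p * n%:R ^+ 3 = n%:R * (n%:R * (p * n%:R)) by ring.
  rewrite ler_wpM2l ?(ltW n0) // ler_pM ?(ltW D0R) ?mulr_ge0 ?(ltW D0R) //.
  by apply: le_trans pn; apply: le_trans x3D; rewrite ler_peMl ?(ltW D0R) //; lra.
have mp : x * D%:R ^+ 2 / m%:R <= p.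
  rewrite ler_pdivrMr //; apply: le_trans h2; rewrite ler_wpM2r ?exprn_ge0 ?(ltW D0R) //.
  by rewrite expr2 ler_peMr //; lra.
split; split=> //.
- apply: degree_le_half_bin => //; first by apply: leq_trans Tl; apply: leq_trans (leq_addl _ 32).
  by apply: (le_trans tau); lra.
- by rewrite -/x; lra.
- rewrite -/x ler_pdivrMr ?exprn_gt0 //.
  have -> : 2 * m%:R * x ^+ 3 = 2 * x ^+ 2 * (x * m%:R) by ring.
  apply: (@le_trans _ _ (2 * x ^+ 2 * (n%:R * D%:R))).
    by rewrite ler_wpM2l ?mulr_ge0 ?exprn_ge0 // ltW.
  have -> : 2 * x ^+ 2 * (n%:R * D%:R) = n%:R * (2 * (x ^+ 2 * D%:R)) by ring.
  have -> : 6 * p * n%:R ^+ 2 = n%:R * (6 * (p * n%:R)) by ring.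
  rewrite ler_wpM2l ?(ltW n0) //.
  have : x ^+ 2 * D%:R <= x ^+ 3 * D%:R.
    by rewrite ler_wpM2r ?(ltW D0R) // [leRHS]exprSr ler_peMr ?exprn_ge0 //; lra.
  have : 0 <= p * n%:R by rewrite mulr_ge0.
  lra.
- rewrite natrM -/x.
  have -> : (x * m%:R * D%:R) ^+ 4 * (2 * x / (x * m%:R)) ^+ (2 * 3) =
    64 * (x ^+ 2 * D%:R ^+ 2 / m%:R) ^+ 2 by field; rewrite !gt_eqF.
  set q := x ^+ 2 * D%:R ^+ 2 / m%:R.
  have q0 : 0 <= q by rewrite divr_ge0.
  have qp : q <= p by rewrite ler_pdivrMr.
  have : q ^+ 2 <= p by rewrite expr2; nra.
  lra.
Qed.
End Admissibility.

(** * Assembling the estimate *)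

Lemma card_tag_fiber (n : nat) (d : 'I_n -> nat) v :
  #|[set p : {v : 'I_n & 'I_(d v)} | tag p == v]| = d v.
Proof.
rewrite -[RHS]card_ord -(card_imset _ (f := fun i : 'I_(d v) => Tagged (fun v => 'I_(d v)) i)).
  apply: eq_card => -[w i]; rewrite inE /=; apply/eqP/imsetP => [e|[j _ e]].
    by subst w; exists i.
  by case: e.
by move=> i j /eqP; rewrite -tag_eqE /tag_eq /= eqxx tagged_asE => /eqP.
Qed.

Theorem theorem1p3 (R : realType) :
  exists (C : R) (n0 : nat), 0 < C /\
  forall (n k m Dstar : nat),
    (n0 <= n)%N -> (0 < n)%N -> (3 <= k)%N -> (0 < m)%N -> (0 < Dstar)%N ->
    psi R n k m Dstar < 1 ->
    forall d : 'I_n -> int,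
      \sum_(v < n) d v = (k * m)%N%:Z ->
      (forall v, d v <= Dstar%:Z) ->
      let main := PrB R k m d *
        expR ((k%:R - 1) / 2 * (1 - n%:R * sigma2 R k m d / (k * m)%:R)) in
      `|PrD R k m d - main| <= C * Num.sqrt (psi R n k m Dstar) * main.
Proof.
(* By [admissible], [3 del + 4 tau + xi] and [7 del + 2 tau] are both at most [27 p]; [expR_le_1Dx]
   turns the first into [1 + 27 exp(27) p]. The lower side loses [459 p], with [459 = 27 + 432], the
   432 coming from repeated blocks. *)
exists (27 * expR 27 + 459), 16%N; split; first by rewrite addr_gt0 // mulr_gt0 ?expR_gt0.
move=> n k m D n16 n0 k3 m0 D0 psi1 d sumd dD.
cbv zeta; set main := PrB R k m d * _.
(* A negative entry makes both probabilities vanish, so natural-number degrees may be assumed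
   afterwards. *)
have [/existsP[v dv]|/existsPn dpos] := boolP [exists v, d v < 0].
  have -> : main = 0.
    by rewrite /main /PrB (bigD1 v) //=; case: (d v) dv => // a _; rewrite mul0r mulr0 mul0r.
  have -> : PrD R k m d = 0.
    rewrite /PrD /num_kgraphs_deg (_ : [set G | _] = set0) ?cards0 ?mul0r //.
    apply/setP => G; rewrite !inE; apply/negP => /and3P[_ _ /forallP/(_ v)/eqP e].
    by rewrite -e in dv.
  by rewrite subrr normr0 mulr0.
pose dn v := `|d v|%N.
have dE v : d v = Posz (dn v) by rewrite /dn gez0_abs // leNgt dpos.
have dnD v : (dn v <= D)%N by rewrite -lez_nat -dE.
have sumdn : (\sum_v dn v = k * m)%N.
  apply/eqP; rewrite -eqz_nat -sumd (big_morph Posz PoszD (erefl _)).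
  by apply/eqP/eq_bigr => v _; rewrite -dE.
have kmnD : (k * m <= n * D)%N.
  by rewrite -sumdn -[n in X in (_ <= X)%N]card_ord -sum_nat_const leq_sum.
have [t [tk t4 [[p0 kn Tl DB] [b1 b2 b3 b4]]]] :
    exists t, [/\ (t < k)%N, (t <= 4)%N & admissible R n k m D t].
  have [k4|k4] := ltnP 3 k.
    by exists 3%N; split=> //; apply: admissible4.
  have k3' : k = 3%N by apply/eqP; rewrite eqn_leq k4 k3.
  by exists 2%N; split; rewrite ?k3' //; apply: admissible3 => //; rewrite -k3'.
set p := psi R n k m D in psi1 p0 b1 b2 b3 b4 *.
pose T : finType := {v : 'I_n & 'I_(dn v)}.
pose vx (x : T) := tag x.
have vxd v : #|[set x | vx x == v]| = dn v by exact: card_tag_fiber.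
have cardT : #|T| = (k * m)%N.
  rewrite -sumdn -sum1_card (partition_big vx xpredT) //=.
  by apply: eq_bigr => v _; rewrite sum1dep_card vxd.
have Tl' : (6 * k * D + 32 <= #|T|)%N by rewrite cardT.
have dfun : PrD R k m d = PrD R k m (fun v => Posz (dn v)) /\
  main = PrB R k m (fun v => Posz (dn v)) *
  expR ((k%:R - 1) / 2 * (1 - n%:R * sigma2 R k m (fun v => Posz (dn v)) / (k * m)%:R)).
  split.
    rewrite /PrD /num_kgraphs_deg; congr (_%:R / _); apply: eq_card => G; rewrite !inE.
    by congr [&& _, _ & _]; apply: eq_forallb => v; rewrite dE.
  rewrite /main /PrB /sigma2; congr (_ * _ * expR (_ * (1 - _ * (_ * _) / _))).
    by apply: eq_bigr => v _; rewrite dE.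
  by apply: eq_bigr => v _; rewrite dE.
have up := PrD_upper R vxd dnD cardT D0 k3 kn Tl' DB.
have lo := PrD_lower vxd dnD cardT D0 k3 kn Tl' DB (rho := 432 * p).
have sl := simple_lower R m vxd dnD D0 k3 Tl' tk t4.
move: up lo; case: dfun => <- <-; rewrite cardT => up lo.
have main0 : 0 <= main.
  by rewrite /main /PrB !mulr_ge0 ?expR_ge0 ?invr_ge0 //; apply: prodr_ge0.
have {}lo : (1 - 459 * p) * main <= PrD R k m d.
  have [h|h] := leP (432 * p) 1; last first.
    apply: (@le_trans _ _ 0); last by rewrite /PrD divr_ge0.
    by rewrite mulr_le0_ge0 //; lra.
  apply: le_trans (lo _).
    rewrite ler_wpM2r //.
    have e27 : 1 - 27 * p <= expR (- (7 * (k%:R * D%:R ^+ 2 / m%:R) + 2 * (D%:R * (k * m)%:R / 'C(n.-1, k.-1)%:R))).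
      by apply: le_trans (expR_ge1Dx _); lra.
    have : (1 - 432 * p) * (1 - 27 * p) <= (1 - 432 * p) * expR (- (7 * (k%:R * D%:R ^+ 2 / m%:R) + 2 * (D%:R * (k * m)%:R / 'C(n.-1, k.-1)%:R))).
      by rewrite ler_wpM2l //; lra.
    by apply: le_trans; nra.
  apply: le_trans sl; rewrite ler_wpM2r // lerD2l lerN2 cardT.
  exact: b4.
have {}up : PrD R k m d <= (1 + 27 * expR 27 * p) * main.
  apply: (le_trans up); rewrite ler_wpM2r //.
  apply: (@le_trans _ _ (expR (27 * p))); first by rewrite ler_expR; lra.
  apply: (le_trans (expR_le_1Dx _)); first by lra.
  have -> : 27 * expR 27 * p = 27 * p * expR 27 by ring.
  by rewrite lerD2l ler_wpM2l ?mulr_ge0 // ler_expR; lra.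
(* The errors so far are linear in [p]; [p < 1] converts them to the square root. *)
have psq : p <= Num.sqrt p.
  rewrite -{1}(sqr_sqrtr p0) expr2 ler_piMr ?sqrtr_ge0 //.
  by rewrite -sqrtr1 ler_wsqrtr // ltW.
have e0 := expR_gt0 (27 : R).
apply: (@le_trans _ _ ((27 * expR 27 + 459) * p * main)); last first.
  by rewrite ler_wpM2r // ler_wpM2l //; lra.
have pm : 0 <= p * main by rewrite mulr_ge0.
have epm : 0 <= expR 27 * (p * main) by rewrite mulr_ge0 // ltW.
rewrite ler_norml; apply/andP; split; lra.
Qed.
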